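(* In the real algebra $M_3(\mathbb{R})$ of $3\times3$ matrices consider $$A=\begin{pmatrix}0&0&0\\0&2\pi&0\\0&0&1\end{pmatrix},\quad B=\begin{pmatrix}0&0&0\\-2\pi&0&0\\0&0&0\end{pmatrix},\quad C=\begin{pmatrix}0&0&0\\0&0&0\\-1&0&0\end{pmatrix}.$$ They satisfy $[A,B]=2\pi B$, $[A,C]=C$, $[B,C]=0$, so that $\mathfrak{g}:=\mathrm{span}_{\mathbb{R}}\{A,B,C\}$ is a Lie subalgebra of $M_3(\mathbb{R})$. The BCH series $Z(X,Y)=\sum_{n=1}^\infty Z_n(X,Y)$ converges in $\mathfrak{g}$ for all $X,Y\in\mathfrak{g}$ close enough to the null matrix, and the map $(X,Y)\mapsto Z(X,Y)$ admits an analytic prolongation to the whole of $\mathfrak{g}\times\mathfrak{g}$: there is a real-analytic map $P:\mathfrak{g}\times\mathfrak{g}\to\mathfrak{g}$ that coincides with $Z$ in a neighbourhood of $(0,0)$. On the other hand, the BCH series $\sum_{n=1}^\infty Z_n(A,B)$ does not converge.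
   Context: The bracket is the matrix commutator $[x,y]=xy-yx$. The BCH series of $x,y$ is the (homogeneous) series $\sum_{n=1}^\infty Z_n(x,y)$, where $Z_n(x,y)$ is the homogeneous Lie polynomial of degree $n$ $$Z_n(x,y)=\frac1n\sum_{k=1}^n\frac{(-1)^{k+1}}{k}\sum_{\substack{(i_1,j_1),\ldots,(i_k,j_k)\neq(0,0)\\ i_1+j_1+\cdots+i_k+j_k=n}}\frac{(\mathrm{ad}\,x)^{i_1}(\mathrm{ad}\,y)^{j_1}\cdots(\mathrm{ad}\,x)^{i_k}(\mathrm{ad}\,y)^{j_k-1}(y)}{i_1!\,j_1!\cdots i_k!\,j_k!},$$ with $i_r,j_r$ nonnegative integers and $(\mathrm{ad}\,a)(b)=[a,b]$; when $j_k=0$ (so $i_k\ne0$) the summand is understood to end with $(\mathrm{ad}\,x)^{i_k-1}(x)$. Equivalently, $Z_n(x,y)$ is the homogeneous component of degree $n$ of $\ln(e^xe^y)$ in the algebra of formal power series over $\mathbb{Q}$ in two non-commuting indeterminates, written as a Lie polynomial. Convergence means convergence in norm of the partial sums $\sum_{n=1}^N Z_n(x,y)$. *)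

(* Defs.v *)
From HB Require Import structures.
From mathcomp Require Import all_boot all_order all_algebra.
From mathcomp Require Import all_classical all_reals all_analysis.
Set Implicit Arguments.
Unset Strict Implicit.
Unset Printing Implicit Defensive.
Import Order.TTheory GRing.Theory Num.Theory.
Import numFieldNormedType.Exports.
Local Open Scope classical_set_scope.
Local Open Scope ring_scope.

Section BCH.
Variables (K : fieldType) (L : algType K).

Definition lie (x y : L) : L := x * y - y * x.

Definition ad (a : L) : L -> L := lie a.

(* For w = [:: (i_1, j_1); ...; (i_k, j_k)], the right-nested bracket
   (ad x)^i_1 (ad y)^j_1 ... (ad x)^i_k (ad y)^(j_k - 1) (y), ending with
   (ad x)^(i_k - 1) (x) when j_k = 0. It is only meaningful for nonempty w
   with (i_k, j_k) != (0, 0). *)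
Fixpoint nested_bracket (x y : L) (w : seq (nat * nat)) : L :=
  match w with
  | [::] => 0
  | [:: (i, j)] =>
      if j is j'.+1 then iter i (ad x) (iter j' (ad y) y)
      else iter i.-1 (ad x) x
  | (i, j) :: w' => iter i (ad x) (iter j (ad y) (nested_bracket x y w'))
  end.

(* Since i_1 + j_1 + ... + i_k + j_k = n, all exponents lie in 'I_n.+1. *)
Definition bch (n : nat) (x y : L) : L :=
  n%:R^-1 *: \sum_(1 <= k < n.+1) ((-1) ^+ k.+1 / k%:R) *:
    \sum_(t : k.-tuple ('I_n.+1 * 'I_n.+1) |
            all (fun p => p != (ord0, ord0)) t && (\sum_(p <- t) (p.1 + p.2) == n)%N)
      (\prod_(p <- t) (p.1`! * p.2`!)%:R)^-1 *:
        nested_bracket x y [seq (val p.1, val p.2) | p <- t].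

(* The index is shifted by one: [series (bch_seq x y) N] is the sum of the
   [bch n x y] for n = 1, ..., N. *)
Definition bch_seq (x y : L) : nat -> L := fun n => bch n.+1 x y.

End BCH.

Section RealAnalytic.
Variable R : realType.

(* Homogeneous part of degree n, at h, of the power series in m variables whose
   coefficient at the multi-index a is c a. *)
Definition mpow_part (m : nat) (c : ('I_m -> nat) -> R) (h : 'I_m -> R)
    (n : nat) : R :=
  \sum_(a : {ffun 'I_m -> 'I_n.+1} | (\sum_i a i == n)%N)
    c (fun i => val (a i)) * \prod_i h i ^+ a i.

(* A power series in m variables converges absolutely at h iff the series of
   its homogeneous parts converges after taking the absolute value of every
   coefficient and every coordinate; its sum may then be taken by degree. *)
Definition analytic_at (m : nat) (f : ('I_m -> R) -> R) (p : 'I_m -> R) : Prop :=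
  exists (c : ('I_m -> nat) -> R) (r : R), 0 < r /\
    forall h : 'I_m -> R, (forall i, `|h i| < r) ->
      cvgn (series (mpow_part (fun a => `|c a|) (fun i => `|h i|))) /\
      series (mpow_part c h) @ \oo --> f (fun i => p i + h i).

(* Analyticity on the whole of a finite-dimensional real vector space, read in
   linear coordinates; it does not depend on the choice of the two bases. *)
Definition real_analytic (U V : vectType R) (f : U -> V) : Prop :=
  let eU := vbasis (@fullv R U) in
  let eV := vbasis (@fullv R V) in
  forall (p : 'I_(\dim (@fullv R U)) -> R) (j : 'I_(\dim (@fullv R V))),
    analytic_at (fun u => coord eV j (f (\sum_i u i *: eU`_i))) p.

End RealAnalytic.

Section Example.
Variable R : realType.

Definition mx3 (rows : seq (seq R)) : 'M[R]_3 :=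
  \matrix_(i, j) nth 0 (nth [::] rows i) j.

Definition mxA : 'M[R]_3 :=
  mx3 [:: [:: 0; 0; 0]; [:: 0; 2 * pi; 0]; [:: 0; 0; 1]].
Definition mxB : 'M[R]_3 :=
  mx3 [:: [:: 0; 0; 0]; [:: - (2 * pi); 0; 0]; [:: 0; 0; 0]].
Definition mxC : 'M[R]_3 :=
  mx3 [:: [:: 0; 0; 0]; [:: 0; 0; 0]; [:: -1; 0; 0]].

Definition gABC : {vspace 'M[R]_3} := <<[:: mxA; mxB; mxC]>>%VS.

End Example.

Arguments mxA {R}.
Arguments mxB {R}.
Arguments mxC {R}.
Arguments gABC : clear implicits.

(* Main.v *)
(** In each of the two weight spaces of [ad A] (weights 2 pi and 1) the algebra acts
    like the affine Lie algebra [(s,u),(t,v)] = (0, s v - t u), whose group law gives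
      log (exp (s,u) exp (t,v)) = (s + t, (phi(s) u + e^s phi(t) v) / phi(s + t)),
    with phi(x) = (e^x - 1)/x. Since phi is analytic and has no real zero, this is
    analytic everywhere. Scaling (s,u), (t,v) by z gives a formal series z W(z), and
    Dynkin's formula is matched with it through its Euler derivative: in a nested
    bracket all but the innermost commutator act as scalars, so the sum over k blocks is
    F^(k-2) times the sum over 2 blocks, with F = e^((s+t)z) - 1, and
    sum_k (-1)^(k+1) F^k / k = ln (1 + F).

    For (A, B) one has s = 2 pi and t = 0, so W (e^(2 pi z) - 1) = 2 pi z e^(2 pi z) up
    to a constant. If the coefficients of W tended to 0, then W(z) = o(1/(1 - |z|)); but
    the imaginary part of the equation at z = i x, with x -> 1, bounds 2 pi by
    o(1/(1 - x)) O(1 - x): W has a simple pole at z = i. *)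

Require Import Defs.
From HB Require Import structures.
From mathcomp Require Import all_boot all_order all_algebra.
From mathcomp Require Import ring lra zify.
From mathcomp Require Import all_classical all_reals all_analysis.
Import Order.TTheory GRing.Theory Num.Theory.
Import numFieldNormedType.Exports.
Set Implicit Arguments.
Unset Strict Implicit.
Unset Printing Implicit Defensive.
Local Open Scope classical_set_scope.
Local Open Scope ring_scope.

(** * Formal power series *)

(** For (A, B) the poles of W nearest to 0 are i and -i, at the same distance from 0 as the point z
    = 1 where the BCH series is summed. The radius of convergence is exactly 1 and settles nothing,
    so divergence has to come from terms that do not tend to 0. Complex numbers are avoided:
    evaluation at i x is replaced by two real series weighted by the real and imaginary parts of
    i^n. The matching with Dynkin's formula is purely formal. Denominators phi((s + t) z) have
    constant term 1, hence can be cancelled in the ring of formal series. Convergence enters only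
    afterwards, through bounds K q^n on coefficients, which are stable under Cauchy products and
    inverses. The same bounds, put on homogeneous parts in several variables, give analyticity. *)

Definition fps (R : Type) : Type := nat -> R.

HB.instance Definition _ (R : Type) := gen_eqMixin (fps R).
HB.instance Definition _ (R : Type) := gen_choiceMixin (fps R).

Section FpsRing.
Variable R : comNzRingType.
Implicit Types f g h F : fps R.

Let zero : fps R := fun=> 0.
Let opp f : fps R := fun n => - f n.
Let add f g : fps R := fun n => f n + g n.
Let one : fps R := fun n => (n == 0%N)%:R.
Let mul f g : fps R := fun n => \sum_(i < n.+1) f i * g (n - i)%N.

Let addA : associative add. Proof. by move=> f g h; apply/funext => n; exact: addrA. Qed.
Let addC : commutative add. Proof. by move=> f g; apply/funext => n; exact: addrC. Qed.
Let add0 : left_id zero add. Proof. by move=> f; apply/funext => n; exact: add0r. Qed.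
Let addN : left_inverse zero opp add.
Proof. by move=> f; apply/funext => n; exact: addNr. Qed.

HB.instance Definition _ := GRing.isZmodule.Build (fps R) addA addC add0 addN.

(** A coefficient of degree at most N only sees truncations, so the ring axioms are inherited from
    [{poly R}]. *)
Let mul_poly N f g n : (n <= N)%N ->
  mul f g n = (\poly_(i < N.+1) f i * \poly_(i < N.+1) g i)`_n.
Proof.
move=> nN; rewrite coefM; apply: eq_bigr => i _; rewrite !coef_poly.
by rewrite !ltnS (leq_trans (leq_subr _ _) nN) (leq_trans _ nN) // -ltnS.
Qed.

(** For associativity one factor is itself a product: the product of truncations is not the
    truncation of the product, but agrees with it up to degree N. *)
Let mul_polyl N (p : {poly R}) f g n : (n <= N)%N ->
    (forall i, (i <= N)%N -> f i = p`_i) ->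
  mul f g n = (p * \poly_(i < N.+1) g i)`_n.
Proof.
move=> nN fp; rewrite coefM; apply: eq_bigr => i _; rewrite !coef_poly.
by rewrite ltnS (leq_trans (leq_subr _ _) nN) fp // (leq_trans _ nN) // -ltnS.
Qed.

Let mulC : commutative mul.
Proof.
by move=> f g; apply/funext => n; rewrite !(@mul_poly n) // mulrC.
Qed.

Let mulA : associative mul.
Proof.
move=> f g h; apply/funext => n; rewrite mulC.
rewrite (@mul_polyl n _ (mul g h) f n _ (fun i iN => mul_poly _ _ iN)) //.
rewrite (@mul_polyl n _ (mul f g) h n _ (fun i iN => mul_poly _ _ iN)) //.
by apply: (congr1 (fun p : {poly R} => p`_n)); ring.
Qed.

Let mul1 : left_id one mul.
Proof.
move=> f; apply/funext => n; rewrite /mul big_ord_recl /= subn0 /one mul1r.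
by rewrite big1 ?addr0 // => i _; rewrite mul0r.
Qed.

Let mulD : left_distributive mul add.
Proof.
move=> f g h; apply/funext => n; rewrite /mul /add -big_split /=.
by apply: eq_bigr => i _; rewrite mulrDl.
Qed.

Let one_neq0 : one != 0.
Proof. by apply/eqP => /(congr1 (fun f : fps R => f 0%N)) /eqP; rewrite oner_eq0. Qed.

(** The alias [fps] keeps this Cauchy product apart from the pointwise product on functions
    [nat -> R]. *)
HB.instance Definition _ :=
  GRing.Zmodule_isComNzRing.Build (fps R) mulA mulC mul1 mulD one_neq0.

Lemma fps1E n : (1 : fps R) n = (n == 0%N)%:R. Proof. by []. Qed.
Lemma fpsDE f g n : (f + g) n = f n + g n. Proof. by []. Qed.
Lemma fpsNE f n : (- f) n = - f n. Proof. by []. Qed.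
Lemma fpsME f g n : (f * g) n = \sum_(i < n.+1) f i * g (n - i)%N.
Proof. by []. Qed.
Lemma fps_mulrnE f k n : (f *+ k) n = f n *+ k.
Proof. by elim: k => [|k IH] //; rewrite !mulrS fpsDE IH. Qed.

Lemma fpsM0E f g : (f * g) 0%N = f 0%N * g 0%N.
Proof. by rewrite fpsME big_ord_recl big_ord0 addr0. Qed.

Definition fpsC (c : R) : fps R := fun n => if n == 0%N then c else 0.
Definition fpsX : fps R := fun n => (n == 1%N)%:R.

Lemma fpsCM c f n : (fpsC c * f) n = c * f n.
Proof.
rewrite fpsME big_ord_recl /= subn0 big1 ?addr0 // => i _.
by rewrite mul0r.
Qed.

Lemma fpsCD c d : fpsC (c + d) = fpsC c + fpsC d.
Proof. by apply/funext => -[|n] //; rewrite fpsDE /= addr0. Qed.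
Lemma fpsCN c : fpsC (- c) = - fpsC c.
Proof. by apply/funext => -[|n] //; rewrite fpsNE /= oppr0. Qed.
Lemma fpsC_mul c d : fpsC (c * d) = fpsC c * fpsC d.
Proof. by apply/funext => -[|n] //; rewrite fpsCM //= mulr0. Qed.
Lemma fpsC0 : fpsC 0 = 0. Proof. by apply/funext => -[]. Qed.
Lemma fpsC1 : fpsC 1 = 1. Proof. by apply/funext => -[]. Qed.

Lemma fpsXM f n : (fpsX * f) n.+1 = f n.
Proof.
rewrite fpsME 2!big_ord_recl /= mul0r add0r subSS subn0 mul1r.
by rewrite big1 ?addr0 // => i _; rewrite mul0r.
Qed.

Lemma fpsXM0 f : (fpsX * f) 0%N = 0.
Proof. by rewrite fpsM0E mul0r. Qed.

Lemma fpsX_inj f g : fpsX * f = fpsX * g -> f = g.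
Proof. by move=> e; apply/funext => n; rewrite -[f n]fpsXM e fpsXM. Qed.

(** Since [f 0 = 1], the coefficient n of [f * g] is [g n] plus terms in earlier coefficients of
    g. *)
Lemma fps_mulI f g h : f 0%N = 1 -> f * g = f * h -> g = h.
Proof.
move=> f0 e; apply/funext => n; elim/ltn_ind: n => n IH.
have /(congr1 (fun F : fps R => F n)) := e.
rewrite !fpsME !(big_ord_recl n) /= f0 !mul1r subn0 => /eqP.
rewrite [X in _ + X == _](eq_bigr (fun i : 'I_n => f (bump 0 i) * h (n - bump 0 i)%N)).
  by rewrite (inj_eq (addIr _)) => /eqP.
by move=> i _; rewrite IH // /bump /= add1n subnS prednK ?leq_subr // subn_gt0 ltn_ord.
Qed.

(** The Euler operator x d/dx. It is a derivation that preserves degrees, and it cancels the factor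
    1/n of [bch n]. *)
Definition theta f : fps R := fun n => f n *+ n.

Lemma thetaD f g : theta (f + g) = theta f + theta g.
Proof. by apply/funext => n; exact: mulrnDl. Qed.

Lemma thetaM f g : theta (f * g) = theta f * g + f * theta g.
Proof.
apply/funext => n; rewrite fpsDE !fpsME /theta -big_split -sumrMnl.
apply: eq_bigr => i _ /=; rewrite mulrnAl mulrnAr -mulrnDr subnKC //.
by rewrite -ltnS.
Qed.

Lemma thetaC c : theta (fpsC c) = 0.
Proof. by apply/funext => -[|n] //; rewrite /theta /= mul0rn. Qed.

Lemma thetaX : theta fpsX = fpsX.
Proof. by apply/funext => -[|[|n]] //; rewrite /theta /= mul0rn. Qed.

(** Substitution of c x for x, a ring endomorphism; [series (sc c f)] evaluates f at c. *)
Definition sc (c : R) f : fps R := fun n => c ^+ n * f n.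

Lemma scD c f g : sc c (f + g) = sc c f + sc c g.
Proof. by apply/funext => n; exact: mulrDr. Qed.
Lemma scN c f : sc c (- f) = - sc c f.
Proof. by apply/funext => n; exact: mulrN. Qed.
Lemma scM c f g : sc c (f * g) = sc c f * sc c g.
Proof.
apply/funext => n; rewrite /sc !fpsME mulr_sumr; apply: eq_bigr => i _.
by rewrite mulrACA -exprD subnKC // -ltnS.
Qed.
Lemma sc1 c : sc c 1 = 1.
Proof. by apply/funext => -[|n]; rewrite /sc fps1E /= ?mulr0 ?mulr1 ?expr0. Qed.
Lemma scX c : sc c fpsX = fpsC c * fpsX.
Proof.
apply/funext => n; rewrite fpsCM /sc /fpsX.
by case: n => [|[|n]] /=; rewrite ?mulr0 // expr1.
Qed.
Lemma scX_exp c f k : sc c (f ^+ k) = sc c f ^+ k.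
Proof. by elim: k => [|k IH]; rewrite ?expr0 ?sc1 // !exprS scM IH. Qed.

Lemma fps_exp_lt F k n : F 0%N = 0 -> (n < k)%N -> (F ^+ k) n = 0.
Proof.
move=> F0; elim: k n => // k IH n; rewrite ltnS => nk.
rewrite exprS fpsME big_ord_recl F0 mul0r add0r big1 // => i _ /=.
rewrite IH ?mulr0 // /bump /= add1n.
by move: (ltn_ord i); lia.
Qed.

(* The composite of the series with coefficients [a] with [F]; it is the usual
   composite only when [F 0 = 0], which makes the truncation at [k <= n] exact. *)
Definition fps_comp (a : nat -> R) F : fps R :=
  fun n => \sum_(k < n.+1) a k * (F ^+ k) n.

(** A truncation common to all degrees up to N, so that sums over powers and over degrees can be
    exchanged. *)
Lemma fps_comp_wide a F n N : F 0%N = 0 -> (n <= N)%N ->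
  fps_comp a F n = \sum_(k < N.+1) a k * (F ^+ k) n.
Proof.
move=> F0 nN; rewrite /fps_comp (big_ord_widen N.+1 (fun k => a k * (F ^+ k) n)) //.
rewrite big_mkcond; apply: eq_bigr => i _; case: ifPn => //.
by rewrite -leqNgt => ni; rewrite fps_exp_lt ?mulr0.
Qed.

Lemma fps_comp_rec a F : F 0%N = 0 ->
  fps_comp a F = fpsC (a 0%N) + F * fps_comp (fun k => a k.+1) F.
Proof.
move=> F0; apply/funext => n; rewrite fpsDE.
rewrite (@fps_comp_wide _ _ n n.+1) // big_ord_recl expr0 fps1E.
congr (_ + _); first by case: n => [|n] /=; rewrite ?mulr0 ?mulr1.
rewrite fpsME.
under eq_bigr => i _ do rewrite exprS fpsME mulr_sumr.
rewrite exchange_big; apply: eq_bigr => i _ /=.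
rewrite (@fps_comp_wide _ _ (n - i) n) ?leq_subr // mulr_sumr.
by apply: eq_bigr => k _; rewrite mulrCA.
Qed.

Lemma theta_exp F k : theta (F ^+ k.+1) = theta F * F ^+ k *+ k.+1.
Proof.
elim: k => [|k IH]; first by rewrite expr1 expr0 mulr1 mulr1n.
by rewrite exprS thetaM IH -[RHS]mulr_natl -[X in _ + F * X]mulr_natl exprS; ring.
Qed.

Lemma theta_comp a F : F 0%N = 0 ->
  theta (fps_comp a F) = theta F * fps_comp (fun k => a k.+1 *+ k.+1) F.
Proof.
move=> F0; apply/funext => n.
rewrite {1}/theta (@fps_comp_wide _ _ n n.+1) // big_ord_recl expr0 fps1E.
rewrite mulrnDl (_ : _ *+ n = 0); last by case: (n) => [|k]; rewrite ?mulr0n // mulr0 mul0rn.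
rewrite add0r -sumrMnl fpsME.
under eq_bigr => i _.
  rewrite -mulrnAr -[_ *+ n]/(theta (F ^+ i.+1) n) theta_exp fps_mulrnE.
  rewrite mulrnAr -mulrnAl fpsME mulr_sumr.
  over.
rewrite exchange_big; apply: eq_bigr => i _ /=.
rewrite (@fps_comp_wide _ _ (n - i) n) ?leq_subr // mulr_sumr.
by apply: eq_bigr => k _; rewrite mulrCA.
Qed.

(** The geometric series of 1 / (1 + (f - 1)), an inverse of f when [f 0 = 1]. *)
Definition fpsinv f : fps R := fps_comp (fun k => (-1) ^+ k) (f - 1).

Lemma fpsMV f : f 0%N = 1 -> f * fpsinv f = 1.
Proof.
move=> f0; have f10 : (f - 1) 0%N = 0 by rewrite fpsDE fpsNE f0 subrr.
set g := fpsinv f.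
have E : g = 1 - (f - 1) * g.
  rewrite {1}/g /fpsinv fps_comp_rec // expr0 fpsC1; congr (_ + _).
  rewrite -mulrN; congr (_ * _); apply/funext => n.
  rewrite fpsNE /g /fpsinv /fps_comp -sumrN; apply: eq_bigr => k _.
  by rewrite exprS mulN1r mulNr.
have -> : f * g = g + (f - 1) * g by ring.
by rewrite {1}E; ring.
Qed.

(** The bounds on inverses, for one series and for homogeneous parts, are both proved by induction
    along this recursion. *)
Lemma fpsinvE f n : f 0%N = 1 ->
  fpsinv f n.+1 = - \sum_(i < n.+1) f i.+1 * fpsinv f (n - i)%N.
Proof.
move=> f0; have /(congr1 (fun F : fps R => F n.+1)) := fpsMV f0.
rewrite fpsME big_ord_recl f0 mul1r subn0 fps1E /= => /eqP.
by rewrite addr_eq0 => /eqP ->.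
Qed.

Lemma fpsinv0 f : f 0%N = 1 -> fpsinv f 0%N = 1.
Proof.
move=> f0; have /(congr1 (fun F : fps R => F 0%N)) := fpsMV f0.
by rewrite fpsM0E f0 mul1r.
Qed.
End FpsRing.

(* The Euler derivative of [bch_fps] below, cleared of its denominator [p ^+ 2]: here
   [a], [b], [p] are phi(s x), phi(t x), phi((s + t) x) and p = 1 + (s + t) x q. *)
Lemma bch_euler_aux (K : comNzRingType) (x s t a b p q u v : K) :
  let es := 1 + s * x * a in let et := 1 + t * x * b in
  let N := u * a + v * (es * b) in
  let d := s * v - t * u in
  p = 1 + (s + t) * x * q ->
  s * a + t * b + s * t * x * a * b = (s + t) * p ->
  p * (u * es + v * (s * x * es * b + es * et)) - N * (es * et - p) =
  p ^+ 2 * (u + v) + p ^+ 2 * (d * x * a) - q * (d * x * (es * et * a - es * b)).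
Proof.
move=> es et N d H1 H2.
have c1 : p - (1 + (s + t) * x * q) = 0 by rewrite {1}H1 subrr.
have c2 : s * a + t * b + s * t * x * a * b - (s + t) * p = 0 by rewrite H2 subrr.
set e1 := (X in X = 0) in c1; set e2 := (X in X = 0) in c2.
apply/eqP; rewrite -subr_eq0; apply/eqP.
(* The identity lies in the ideal generated by the two relations; the cofactors are given
   explicitly, so that [ring] can check it. *)
suff -> : p * (u * es + v * (s * x * es * b + es * et)) - N * (es * et - p) -
    (p ^+ 2 * (u + v) + p ^+ 2 * (d * x * a) -
     q * (d * x * (es * et * a - es * b))) =
    e1 * (u * (- p + t * x * a * p + a) + v * es * (b - p)) +
    e2 * (u * (- a * x - t * x ^+ 2 * q * a + x * q) + v * es * (x * q - b * x)).
  by rewrite c1 c2 !mul0r addr0.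
by rewrite /e1 /e2 /N /d /es /et; ring.
Qed.

(** * Formal exponential and logarithm *)

Section FpsExp.
Variable R : numFieldType.

(** In this order: the series of e^x, (e^x - 1)/x and (e^x - 1 - x)/x^2. *)
Definition fps_exp : fps R := fun n => n`!%:R^-1.
Definition fps_phi : fps R := fun n => n.+1`!%:R^-1.
Definition fps_psi : fps R := fun n => n.+2`!%:R^-1.

Notation X := (fpsX R).

Let fact_neq0 n : n`!%:R != 0 :> R.
Proof. by rewrite pnatr_eq0 -lt0n fact_gt0. Qed.

Let invfactS n : n.+1`!%:R^-1 *+ n.+1 = n`!%:R^-1 :> R.
Proof.
rewrite factS natrM -mulr_natr; field.
by rewrite fact_neq0 nat1r pnatr_eq0.
Qed.

Lemma fps_expE : fps_exp = 1 + X * fps_phi.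
Proof.
apply/funext => -[|n]; rewrite fpsDE fps1E ?fpsXM0 ?fpsXM /= ?addr0 ?add0r //.
by rewrite /fps_exp invr1.
Qed.

Lemma fps_phiE : fps_phi = 1 + X * fps_psi.
Proof.
apply/funext => -[|n]; rewrite fpsDE fps1E ?fpsXM0 ?fpsXM /= ?addr0 ?add0r //.
by rewrite /fps_phi invr1.
Qed.

Lemma theta_fps_exp : theta fps_exp = X * fps_exp.
Proof.
apply/funext => -[|n]; rewrite ?fpsXM0 ?fpsXM //.
exact: invfactS.
Qed.

Lemma theta_fps_phi : theta fps_phi = fps_exp - fps_phi.
Proof.
apply/funext => n; rewrite fpsDE fpsNE /theta; apply/eqP.
by rewrite eq_sym subr_eq -mulrSr; apply/eqP; rewrite /fps_phi invfactS.
Qed.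

Lemma theta_sc (c : R) f : theta (sc c f) = sc c (theta f).
Proof. by apply/funext => n; rewrite /theta /sc mulrnAr. Qed.

Lemma fps_expD c d : sc c fps_exp * sc d fps_exp = sc (c + d) fps_exp.
Proof.
apply/funext => n; rewrite fpsME /sc /fps_exp addrC exprDn mulr_suml.
apply: eq_bigr => i _; have lein : (i <= n)%N by rewrite -ltnS.
have e : n`!%:R = 'C(n, i)%:R * (i`!%:R * (n - i)`!%:R) :> R.
  by rewrite -!natrM bin_fact.
rewrite e -mulr_natr; field.
by rewrite !fact_neq0 pnatr_eq0 -lt0n bin_gt0 lein.
Qed.

Let log_coef (k : nat) : R := if k == 0%N then 0 else (-1) ^+ k.+1 / k%:R.

(* Coefficients of [(ln(1+x) - x)/x^2]. *)
Definition log2_coef (k : nat) : R := (-1) ^+ k.+1 / k.+2%:R.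

Let F := fps_exp - 1.
Let F0 : F 0%N = 0.
Proof. by rewrite /F fpsDE fpsNE /fps_exp invr1 subrr. Qed.

(** ln(1 + (e^x - 1)) = x: both sides have constant term 0 and the same Euler derivative, that of
    the left being x e^x times the inverse of e^x. *)
Let log_exp : fps_comp log_coef F = X.
Proof.
have th : theta (fps_comp log_coef F) = X.
  rewrite theta_comp // (_ : (fun k => log_coef k.+1 *+ k.+1) = fun k => (-1) ^+ k); last first.
    apply/funext => k; rewrite /log_coef /= -[LHS]mulr_natr mulfVK ?pnatr_eq0 //.
    by rewrite !exprS !mulN1r opprK.
  rewrite {1}/F thetaD (_ : theta (- 1) = 0) ?addr0; last first.
    by rewrite -fpsC1 -fpsCN thetaC.
  rewrite theta_fps_exp -[X in X = _]mulrA -[LHS]/(X * (fps_exp * fpsinv fps_exp)).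
  by rewrite fpsMV ?mulr1 // /fps_exp invr1.
apply/funext => -[|n]; first by rewrite /fps_comp big_ord1 expr0 /log_coef mul0r.
have /(congr1 (fun f : fps R => f n.+1)) := th.
rewrite /theta /fpsX => /eqP; case: n => [|n] /=; first by rewrite mulr1n => /eqP.
by rewrite mulrn_eq0 /= => /eqP.
Qed.

(** As F = x phi, one has (ln(1 + F) - F)/F^2 = (x - x phi)/(x phi)^2 = - psi/phi^2. *)
Lemma log2_phi : fps_comp log2_coef F * fps_phi ^+ 2 = - fps_psi.
Proof.
have FX : F = X * fps_phi by rewrite /F fps_expE; ring.
have e : X = F * (1 + F * fps_comp log2_coef F).
  rewrite -{1}log_exp fps_comp_rec // fps_comp_rec // /log_coef /=.
  rewrite fpsC0 add0r -signr_odd expr0 divr1 fpsC1; congr (_ * (_ + _ * fps_comp _ _)).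
  by apply/funext => k; rewrite /log2_coef !exprS mulrA mulrNN !mul1r.
have e1 : 1 = fps_phi * (1 + X * fps_phi * fps_comp log2_coef F).
  by apply: fpsX_inj; rewrite mulr1 {1}e -FX {1}FX mulrA.
apply: fpsX_inj.
apply: (@addrI _ fps_phi).
rewrite mulrN {3}fps_phiE addrK [in RHS]e1; ring.
Qed.
End FpsExp.

(** * Sums over Dynkin's words *)

Section TupleSums.
Variables (n : nat).
Let T := ('I_n.+1 * 'I_n.+1)%type.

Definition nonzero_block (p : T) := p != (ord0, ord0).
Definition block_degree (p : T) : nat := p.1 + p.2.

Definition blocks_of_degree (d : nat) (s : seq T) :=
  all nonzero_block s && (\sum_(p <- s) block_degree p == d)%N.

Lemma nonzero_blockE (p : T) : nonzero_block p = (block_degree p != 0)%N.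
Proof.
case: p => i j; rewrite /nonzero_block /block_degree xpair_eqE /= addn_eq0.
by rewrite -!val_eqE.
Qed.

Lemma big_cons_tuple (V : nmodType) k (P : pred (seq T)) (G : seq T -> V) :
  \sum_(t : k.+1.-tuple T | P t) G t =
  \sum_(p : T) \sum_(t : k.-tuple T | P (p :: t)) G (p :: t).
Proof.
rewrite (pair_big_dep xpredT (fun (p : T) (t : k.-tuple T) => P (p :: t))
  (fun p t => G (p :: t))) /=.
rewrite (reindex (fun q : T * k.-tuple T => cons_tuple q.1 q.2)) //=.
exists (fun t : k.+1.-tuple T => (thead t, behead_tuple t)).
  by move=> [p t] _ /=; rewrite theadE; congr (_, _); apply: val_inj.
by move=> t _ /=; rewrite [t in RHS]tuple_eta.
Qed.

(** Splitting off the first block gives a convolution over its degree; this is how products of power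
    series arise from words. *)
Lemma sum_blocks_cons (V : nmodType) k d (G : seq T -> V) :
  \sum_(t : k.+1.-tuple T | blocks_of_degree d t) G t =
  \sum_(a < d.+1) \sum_(p : T | nonzero_block p && (block_degree p == a))
    \sum_(t : k.-tuple T | blocks_of_degree (d - a) t) G (p :: t).
Proof.
rewrite (big_cons_tuple _ (fun s => blocks_of_degree d s)).
under [RHS]eq_bigr => a _ do rewrite big_mkcond.
rewrite exchange_big; apply: eq_bigr => p _ /=.
rewrite /blocks_of_degree /=; case: (boolP (nonzero_block p)) => pnz /=; last first.
  by rewrite [LHS]big_pred0 // [RHS]big1.
have [pd|pd] := leqP (block_degree p) d; last first.
  rewrite [LHS]big_pred0; last first.
    by move=> t; rewrite big_cons; apply/negbTE/nandP; right; apply/eqP; lia.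
  rewrite big1 // => a _; case: ifP => // /eqP e.
  by move: (ltn_ord a); lia.
have lt : (block_degree p < d.+1)%N by [].
rewrite (bigD1 (Ordinal lt)) //= eqxx [X in _ + X]big1 ?addr0; last first.
  by move=> a /eqP ne; case: ifP => // /eqP e; case: ne; apply: val_inj.
apply: eq_bigl => t; rewrite big_cons; congr (_ && _).
by apply/eqP/eqP; lia.
Qed.

(** The bound [d <= n] ensures that both exponents of every pair (i, d - i) fit in ['I_n.+1]. *)
Lemma sum_block_degree (V : nmodType) d (H : nat -> nat -> V) :
  (0 < d)%N -> (d <= n)%N ->
  \sum_(p : T | nonzero_block p && (block_degree p == d)) H p.1 p.2 =
  \sum_(i < d.+1) H i (d - i)%N.
Proof.
move=> d0 dn.
under eq_bigl => p.
  rewrite nonzero_blockE (_ : _ && _ = (block_degree p == d)); last first.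
    by case: (block_degree p =P d) => [->|]; rewrite ?andbF ?andbT // -lt0n d0.
  over.
rewrite (reindex_onto (fun i : 'I_d.+1 => (inord i, inord (d - i)) : T)
  (fun p : T => inord p.1)) /=; last first.
  move=> [i j] /= /eqP; rewrite /block_degree /= => e.
  have lei : (i < d.+1)%N by lia.
  by congr (_, _); apply: val_inj; rewrite /= inordK ?inordK //; lia.
have ord_le (i : 'I_d.+1) : (i <= d)%N by rewrite -ltnS.
apply: eq_big => [i|i _].
  rewrite /block_degree /= !inordK; try by move: (ord_le i); lia.
  by rewrite subnKC // eqxx /=; apply/eqP/val_inj; rewrite /= inordK.
by rewrite !inordK //; move: (ord_le i); lia.
Qed.

Lemma sum_block_degree0 (V : nmodType) (H : T -> V) :
  \sum_(p : T | nonzero_block p && (block_degree p == 0)%N) H p = 0.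
Proof.
by rewrite big_pred0 // => p; rewrite nonzero_blockE andbC; case: eqP.
Qed.

Lemma sum_block1 (V : nmodType) d (G : seq T -> V) :
  \sum_(t : 1.-tuple T | blocks_of_degree d t) G t =
  \sum_(p : T | nonzero_block p && (block_degree p == d)) G [:: p].
Proof.
rewrite (big_cons_tuple _ (fun s => blocks_of_degree d s)) [RHS]big_mkcond.
apply: eq_bigr => p _; rewrite /blocks_of_degree /=.
rewrite big_mkcond (bigD1 [tuple]) //= [X in _ + X]big1 ?addr0; last first.
  by move=> t /eqP[]; exact: tuple0.
by rewrite big_cons big_nil addn0 andbT.
Qed.
End TupleSums.

(** * The BCH series of the affine Lie algebra *)

Section BchSeries.
Variable R : numFieldType.
Implicit Types s t u v : R.

Notation X := (fpsX R).
Notation E c := (sc c (fps_exp R)).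
Notation Phi c := (sc c (fps_phi R)).

(* In the affine Lie algebra [(s,u),(t,v)] = (0, s v - t u), the second component of
   the degree [n+1] part of the BCH series of (s,u) and (t,v) is [bch_fps s t u v n]; it
   is read off the group law via exp (s,u) = (s, phi(s) u), phi(x) = (e^x - 1)/x. *)
Definition bch_fps_num s t u v : fps R := fpsC u * Phi s + fpsC v * (E s * Phi t).
Definition bch_fps s t u v : fps R := bch_fps_num s t u v * fpsinv (Phi (s + t)).

Let Phi0 c : Phi c 0%N = 1.
Proof. by rewrite /sc expr0 mul1r /fps_phi invr1. Qed.

Let EE c : E c = 1 + fpsC c * X * Phi c.
Proof. by rewrite fps_expE scD sc1 scM scX. Qed.

Lemma bch_fpsM s t u v : bch_fps s t u v * Phi (s + t) = bch_fps_num s t u v.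
Proof. by rewrite /bch_fps -mulrA [fpsinv _ * _]mulrC fpsMV // mulr1. Qed.

(** Generating functions, in the degree, of the sums over words of one block ([dynkin1]) and of two
    blocks ([dynkin2]), as [D1E] and [D2E] show. *)
Definition dynkin1 s t u v : fps R :=
  X * fpsC (u + v) + fpsC (s * v - t * u) * X ^+ 2 * Phi s.
Definition dynkin2 s t u v : fps R :=
  fpsC (s * v - t * u) * X ^+ 2 * (E (s + t) * Phi s - E s * Phi t).

(** The right side is Dynkin's series freed of 1/n: words of k + 2 blocks contribute F^k [dynkin2]
    with the coefficient [log2_coef k]. *)
Lemma bch_fps_dynkin s t u v :
  theta (X * bch_fps s t u v) = dynkin1 s t u v +
    fps_comp (log2_coef R) (E (s + t) - 1) * dynkin2 s t u v.
Proof.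
set m := s + t; set W := bch_fps s t u v.
have thE c : theta (E c) = fpsC c * X * E c.
  by rewrite theta_sc theta_fps_exp scM scX.
have thPhi c : theta (Phi c) = E c - Phi c.
  by rewrite theta_sc theta_fps_phi scD scN.
have L2 : fps_comp (log2_coef R) (E m - 1) * Phi m ^+ 2 = - sc m (fps_psi R).
  have := congr1 (sc m) (log2_phi R); rewrite scM scX_exp scN => <-.
  congr (_ * _); apply/funext => n.
  rewrite /sc /fps_comp mulr_sumr; apply: eq_bigr => k _.
  by rewrite mulrCA -[_ * ((fps_exp R - 1) ^+ k) n]/(sc m _ n) scX_exp scD scN sc1.
have PhiE : Phi m = 1 + (fpsC s + fpsC t) * X * sc m (fps_psi R).
  by rewrite -fpsCD {1}fps_phiE scD sc1 scM scX.
(* This is e^(s x) e^(t x) = e^((s + t) x) with the constant term and one factor x removed. *)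
have mul : fpsC s * Phi s + fpsC t * Phi t + fpsC s * fpsC t * X * Phi s * Phi t
    = (fpsC s + fpsC t) * Phi m.
  apply: fpsX_inj; apply: (@addrI _ 1).
  transitivity (E s * E t); first by rewrite !EE; ring.
  by rewrite fps_expD EE fpsCD; ring.
have key := bch_euler_aux (fpsC u) (fpsC v) PhiE mul.
have WPhi : W * Phi m = bch_fps_num s t u v by exact: bch_fpsM.
have thN : theta (bch_fps_num s t u v) =
    theta W * Phi m + W * (E m - Phi m) by rewrite -WPhi thetaM thPhi.
have thN2 : theta (bch_fps_num s t u v) = fpsC u * (E s - Phi s) +
    fpsC v * (fpsC s * X * E s * Phi t + E s * (E t - Phi t)).
  by rewrite /bch_fps_num thetaD !thetaM !thetaC !thPhi thE; ring.
rewrite thetaM thetaX /dynkin1 /dynkin2.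
rewrite !(fpsCD, fpsCN, fpsC_mul).
(* Multiplying twice by phi((s + t) x) clears the denominator of the derivative of W and, by [L2],
   that of the logarithmic factor. *)
apply: (@fps_mulI _ (Phi m)) => //; apply: (@fps_mulI _ (Phi m)) => //.
move: key; rewrite -!EE fps_expD -/m.
set L := fps_comp _ _ in L2 *.
set N := bch_fps_num _ _ _ _ in WPhi thN thN2.
have -> : fpsC u * Phi s + fpsC v * (E s * Phi t) = N by [].
move=> key.
have -> : Phi m * (Phi m * (X * W + X * theta W)) =
    X * (Phi m * (W * Phi m) + Phi m * (theta W * Phi m + W * (E m - Phi m))
      - (W * Phi m) * (E m - Phi m)) by ring.
rewrite -thN thN2 WPhi.
have -> : X * (Phi m * N + Phi m * (fpsC u * (E s - Phi s) +
    fpsC v * (fpsC s * X * E s * Phi t + E s * (E t - Phi t))) - N * (E m - Phi m))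
  = X * (Phi m * (fpsC u * E s + fpsC v * (fpsC s * X * E s * Phi t + E s * E t))
      - N * (E m - Phi m)).
  by rewrite /N /bch_fps_num; ring.
have psiE : sc m (fps_psi R) = - (L * Phi m ^+ 2) by rewrite L2 opprK.
rewrite fps_expD -/m key psiE.
by ring.
Qed.
End BchSeries.

(** * Evaluation of Dynkin's formula in affine coordinates *)

Section LieClosed.
Variables (K : fieldType) (L : algType K) (G : L -> Prop).
Hypothesis G0 : G 0.
Hypothesis G_lie : forall x y, G x -> G y -> G (lie x y).

Lemma iter_ad_closed a k z : G a -> G z -> G (iter k (ad a) z).
Proof. by move=> Ga Gz; elim: k => // k IH; exact: G_lie. Qed.

Lemma nested_bracket_closed x y w : G x -> G y -> G (nested_bracket x y w).
Proof.
move=> Gx Gy; elim: w => [|[i j] [|q w] IH] //=; last by do 2 apply: iter_ad_closed => //.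
by case: j => [|j]; do ?apply: iter_ad_closed.
Qed.
End LieClosed.

Section AffineBch.
Variables (K : numFieldType) (L : algType K).
(* [dg] and [e] are the coordinates s and u of the affine Lie algebra above. *)
Variables (G : L -> Prop) (dg e : L -> K).
Hypothesis G0 : G 0.
Hypothesis G_lie : forall x y, G x -> G y -> G (lie x y).
Hypothesis dg_lie : forall x y, G x -> G y -> dg (lie x y) = 0.
Hypothesis eD : {morph e : x y / x + y}.
Hypothesis eZ : forall c x, e (c *: x) = c * e x.
Hypothesis e_lie : forall x y, G x -> G y -> e (lie x y) = dg x * e y - dg y * e x.
Variables x y : L.
Hypotheses (Gx : G x) (Gy : G y).

Notation s := (dg x).
Notation t := (dg y).
Notation u := (e x).
Notation v := (e y).
Let d := s * v - t * u.

Let e0 : e 0 = 0. Proof. by rewrite -(scale0r 0) eZ mul0r. Qed.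

(** On elements with [dg z = 0], which include all commutators, [ad a] multiplies the coordinate e
    by [dg a]. *)
Let iter_ad a k z : G a -> G z -> dg z = 0 ->
  [/\ G (iter k (ad a) z), dg (iter k (ad a) z) = 0 &
      e (iter k (ad a) z) = dg a ^+ k * e z].
Proof.
move=> Ga Gz z0; elim: k => [|k [IG I0 Ie]] /=; first by rewrite expr0 mul1r.
split; [exact: G_lie|exact: dg_lie|].
by rewrite /ad e_lie // I0 Ie mul0r subr0 exprS mulrA.
Qed.

Let G_iter_ad a k z : G a -> G z -> G (iter k (ad a) z).
Proof. exact: iter_ad_closed. Qed.

Let iter_ad0 (a : L) k : iter k (ad a) 0 = 0.
Proof. by elim: k => //= k ->; rewrite /ad /lie mulr0 mul0r subrr. Qed.

Let iter_ad_self (a : L) k : iter k.+1 (ad a) a = 0.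
Proof.
rewrite iterSr (_ : ad a a = 0); last exact: subrr.
exact: iter_ad0.
Qed.

Let G_nested w : G (nested_bracket x y w).
Proof. exact: nested_bracket_closed. Qed.

Let nested_cons p q w : nested_bracket x y (p :: q :: w) =
  iter p.1 (ad x) (iter p.2 (ad y) (nested_bracket x y (q :: w))).
Proof. by case: p. Qed.

Let dg_iter2 (i j : nat) z : G z -> (i + j != 0)%N ->
  dg (iter i (ad x) (iter j (ad y) z)) = 0.
Proof.
move=> Gz; case: i => [|i] /=; last first.
  by move=> _; apply: dg_lie => //; apply: G_iter_ad => //; apply: G_iter_ad.
by case: j => [|j] //= _; apply: dg_lie => //; apply: G_iter_ad.
Qed.

Let e_iter2 (i j : nat) z : G z -> dg z = 0 ->
  e (iter i (ad x) (iter j (ad y) z)) = s ^+ i * t ^+ j * e z.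
Proof.
move=> Gz z0; have [Gj j0 ej] := iter_ad j Gy Gz z0.
by have [_ _ ->] := iter_ad i Gx Gj j0; rewrite ej mulrA.
Qed.

(** The operator nearest to x decides: [y, x] has coordinate -d, after which everything is scalar,
    whereas [x, x] = 0. *)
Let e_iter2x (i j : nat) : (i + j != 0)%N ->
  e (iter i (ad x) (iter j (ad y) x)) = if j is j'.+1 then - (s ^+ i * t ^+ j' * d) else 0.
Proof.
case: j => [|j] ij.
  by case: i ij => // i _; rewrite [iter 0 _ _]/= iter_ad_self e0.
rewrite iterSr e_iter2; [|exact: G_lie|exact: dg_lie].
by rewrite /ad e_lie // /d; ring.
Qed.

Let e_iter2y (i j : nat) : (i + j != 0)%N ->
  e (iter i (ad x) (iter j (ad y) y)) =
  if j is j'.+1 then 0 else s ^+ i.-1 * d.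
Proof.
case: j => [|j] ij; last first.
  by rewrite iter_ad_self iter_ad0 e0.
case: i ij => // i _; rewrite [iter 0 _ _]/= iterSr [ad x y]/(lie x y).
have [_ _ ->] := iter_ad i Gx (G_lie Gx Gy) (dg_lie Gx Gy).
by rewrite e_lie.
Qed.

(** The block (0, 0) gets the value u because [0.-1 = 0]; it is excluded from all the sums. *)
Let e_single (i j : nat) : e (nested_bracket x y [:: (i, j)]) =
  match j with
  | 0 => if (i <= 1)%N then u else 0
  | 1 => if i is i'.+1 then s ^+ i' * d else v
  | _ => 0
  end.
Proof.
rewrite /=; case: j => [|[|j]]; first by case: i => [|[|i]] //=; rewrite -[ad x _]/(iter i.+1 (ad x) x) iter_ad_self e0.
  case: i => // i; have := @e_iter2y i.+1 0 isT; by [].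
by rewrite iter_ad_self iter_ad0 e0.
Qed.

Let dg_single (i j : nat) : (1 < i + j)%N -> dg (nested_bracket x y [:: (i, j)]) = 0.
Proof.
move=> ij /=; case: j ij => [|j] ij; first by apply: (@dg_iter2 i.-1 0) => //; lia.
by apply: dg_iter2 => //; lia.
Qed.

Section Degree.
Variable n : nat.
Let T := ('I_n.+1 * 'I_n.+1)%type.

Let nb (w : seq T) := nested_bracket x y [seq (val p.1, val p.2) | p <- w].
Let wt (p : T) : K := (p.1`! * p.2`!)%:R^-1.

Let term (w : seq T) : K := (\prod_(p <- w) wt p) * e (nb w).

(** The exponent type depends on the fixed n while the degree m varies, so blocks can be split off
    without changing types. For m <= n the bound on exponents loses no word. *)
Let D k m : K := \sum_(w : k.-tuple T | blocks_of_degree m w) term w.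

(** From degree 2 on, the only single block with a nonzero value is (m - 1, 1). *)
Let D1E m : (m <= n)%N -> D 1 m = dynkin1 s t u v m.
Proof.
move=> mn; rewrite /D (sum_block1 _ term).
under eq_bigr => p _ do rewrite /term big_seq1 /nb /=.
rewrite /dynkin1 fpsDE; case: m mn => [|m] mn.
  by rewrite sum_block_degree0 fpsXM0 expr2 -!mulrA mulrCA fpsXM0 addr0.
rewrite (@sum_block_degree _ _ _ (fun i j => (i`! * j`!)%:R^-1 *
   e (nested_bracket x y [:: (i, j)]))) //.
under eq_bigr => i _ do rewrite e_single.
rewrite fpsXM.
have -> : fpsC (s * v - t * u) * fpsX K ^+ 2 * sc s (fps_phi K) =
  fpsX K * (fpsX K * (fpsC d * sc s (fps_phi K))) by rewrite /d; ring.
rewrite fpsXM; case: m mn => [|m] mn.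
  rewrite !big_ord_recr big_ord0 /= fpsXM0 !fact0 !invr1 !mul1r add0r addr0 /=.
  by rewrite addrC.
rewrite 2!big_ord_recr /= subnn subSnn big1 ?add0r; last first.
  move=> i _.
  case E : (m.+2 - i)%N => [|[|j]]; rewrite ?mulr0 //;
  by move: (ltn_ord i); lia.
rewrite mulr0 addr0 fpsXM fpsCM /sc /fps_phi muln1.
by ring.
Qed.

Let F := sc (s + t) (fps_exp K) - 1.

Let F0 : F 0%N = 0.
Proof. by rewrite /F fpsDE fpsNE /sc /fps_exp fps1E invr1 expr0 mulr1 subrr. Qed.

(** A block acting by scalars contributes s^i t^j / (i! j!), a term of e^(s z) e^(t z); leaving out
    the zero block subtracts 1. *)
Let F_block a : (a <= n)%N ->
  \sum_(p : T | nonzero_block p && (block_degree p == a))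
     wt p * (s ^+ p.1 * t ^+ p.2) = F a.
Proof.
case: a => [|a] an; first by rewrite sum_block_degree0 F0.
rewrite (@sum_block_degree _ _ _ (fun i j => (i`! * j`!)%:R^-1 * (s ^+ i * t ^+ j))) //.
rewrite /F -fps_expD fpsDE fpsNE fps1E /= subr0 fpsME.
by apply: eq_bigr => i _; rewrite /sc /fps_exp natrM invfM; ring.
Qed.

Let D_cons k m : D k.+1 m =
  \sum_(a < m.+1) \sum_(p : T | nonzero_block p && (block_degree p == a)) wt p *
    \sum_(w : k.-tuple T | blocks_of_degree (m - a) w)
      (\prod_(q <- w) wt q) * e (nb (p :: w)).
Proof.
rewrite /D (sum_blocks_cons _ _ term); apply: eq_bigr => a _.
apply: eq_bigr => p _; rewrite mulr_sumr; apply: eq_bigr => w _.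
by rewrite /term big_cons mulrA.
Qed.

(** After the first block at least two remain, so the inner bracket is a commutator and the first
    block is scalar. A single remaining block could be the bare x or y, where this fails. *)
Let DSE k m : (m <= n)%N -> D k.+3 m = \sum_(a < m.+1) F a * D k.+2 (m - a)%N.
Proof.
move=> mn; rewrite D_cons; apply: eq_bigr => a _.
have an : (a <= n)%N by apply: leq_trans mn; rewrite -ltnS.
rewrite -F_block // mulr_suml; apply: eq_bigr => p _.
rewrite -mulrA; congr (_ * _); rewrite /D mulr_sumr; apply: eq_bigr => w /andP[+ _].
rewrite /term; case: w => -[//|q1 [//|q2 w]] /= _ /and3P[nz1 _ _].
rewrite mulrCA; congr (_ * _); rewrite /nb [map _ _]/= nested_cons e_iter2 //.
rewrite [map _ _]/= nested_cons; apply: dg_iter2 => //.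
by move: nz1; rewrite nonzero_blockE.
Qed.

(** [A] accounts for last blocks that are commutators, [B] for first blocks applied to a last block
    equal to x or y. The two-block sum is F A + B X. *)
Let A : fps K := fpsC d * fpsX K ^+ 2 * sc s (fps_phi K).
Let B : fps K := fpsX K * (fpsC d * (sc s (fps_phi K) - sc s (fps_exp K) * sc t (fps_phi K))).

Let A_dynkin : dynkin1 s t u v = fpsX K * fpsC (u + v) + A. Proof. by []. Qed.

Let AE : A = fpsX K * (fpsX K * (fpsC d * sc s (fps_phi K))).
Proof. by rewrite /A; ring. Qed.

(** A last block of degree 1 is x or y and yields the correction term; any longer one is a
    commutator, on which p acts as a scalar. *)
Let pair_sum m (p : T) : (0 < n)%N -> (m <= n)%N ->
  \sum_(w : 1.-tuple T | blocks_of_degree m w)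
      (\prod_(q <- w) wt q) * e (nb (p :: w)) =
  s ^+ p.1 * t ^+ p.2 * A m +
  (m == 1%N)%:R * (e (iter p.1 (ad x) (iter p.2 (ad y) x)) +
                   e (iter p.1 (ad x) (iter p.2 (ad y) y))).
Proof.
move=> n0 mn; rewrite (sum_block1 _ (fun w => (\prod_(q <- w) wt q) * e (nb (p :: w)))).
under eq_bigr => q _ do rewrite big_seq1 /nb [map _ _]/= nested_cons.
case: m mn => [|[|m]] mn.
- by rewrite sum_block_degree0 AE fpsXM0 mulr0 mul0r addr0.
- rewrite (@sum_block_degree _ _ _ (fun i j => (i`! * j`!)%:R^-1 *
    e (iter p.1 (ad x) (iter p.2 (ad y) (nested_bracket x y [:: (i, j)]))))) //.
  rewrite !big_ord_recr big_ord0 /= AE fpsXM fpsXM0 !fact0 (_ : 1`! = 1%N) // !muln1 !invr1.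
  by rewrite !mul1r mulr0 !add0r addrC.
- rewrite mul0r addr0 (_ : A m.+2 = D 1 m.+2); last first.
    by rewrite D1E // A_dynkin fpsDE fpsXM add0r.
  rewrite /D (sum_block1 _ term) mulr_sumr; apply: eq_bigr => q /andP[_ /eqP qm].
  rewrite /term big_seq1 /nb [map _ _]/= mulrCA; congr (_ * _).
  rewrite (e_iter2 _ _ (G_nested [:: (val q.1, val q.2)])) //.
  by apply: dg_single; rewrite [X in (_ < X)%N]qm.
Qed.

Let B_block a : (a <= n)%N ->
  \sum_(p : T | nonzero_block p && (block_degree p == a))
    wt p * (e (iter p.1 (ad x) (iter p.2 (ad y) x)) +
            e (iter p.1 (ad x) (iter p.2 (ad y) y))) = B a.
Proof.
case: a => [|a] an; first by rewrite sum_block_degree0 /B fpsXM0.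
rewrite (@sum_block_degree _ _ _ (fun i j => (i`! * j`!)%:R^-1 *
    (e (iter i (ad x) (iter j (ad y) x)) +
            e (iter i (ad x) (iter j (ad y) y))))) //.
rewrite big_ord_recr [RHS]fpsXM fpsCM fpsDE fpsNE fpsME [(a.+1 - _)%N]/= subnn.
rewrite e_iter2x // e_iter2y // add0r fact0 muln1 [RHS]mulrDr.
apply: (etrans (addrC _ _)); congr (_ + _).
  by rewrite /sc /fps_phi [a.+1.-1]/=; ring.
rewrite -sumrN mulr_sumr; apply: eq_bigr => i _ /=.
have ia : (i <= a)%N by rewrite -ltnS.
rewrite subSn // e_iter2x ?addnS // e_iter2y ?addnS // addr0.
by rewrite /sc /fps_exp /fps_phi natrM invfM; ring.
Qed.

Let D2E m : (m <= n)%N -> D 2 m = dynkin2 s t u v m.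
Proof.
move=> mn; have -> : dynkin2 s t u v = F * A + B * fpsX K.
  by rewrite /dynkin2 /A /B /F /d; ring.
rewrite D_cons fpsDE !fpsME -big_split; apply: eq_bigr => a _ /=.
have an : (a <= n)%N by apply: leq_trans mn; rewrite -ltnS.
have [n0|n0] := posnP n.
  have -> : a = 0%N :> nat by lia.
  rewrite sum_block_degree0 F0 /B fpsXM0 !mul0r addr0 //.
rewrite -F_block // -B_block // !mulr_suml -big_split; apply: eq_bigr => p _ /=.
rewrite pair_sum //; last by apply: leq_trans mn; rewrite leq_subr.
by rewrite /fpsX; ring.
Qed.

Let DE k m : (m <= n)%N -> D k.+2 m = (F ^+ k * dynkin2 s t u v) m.
Proof.
elim: k m => [|k IH] m mn; first by rewrite expr0 mul1r D2E.
rewrite DSE // exprS -mulrA fpsME; apply: eq_bigr => a _.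
by rewrite IH // (leq_trans _ mn) // leq_subr.
Qed.

Let e_bchE : e (bch n x y) =
  n%:R^-1 * \sum_(1 <= k < n.+1) ((-1) ^+ k.+1 / k%:R) * D k n.
Proof.
rewrite /bch eZ (big_morph e eD e0); congr (_ * _); apply: eq_bigr => k _.
rewrite eZ (big_morph e eD e0); congr (_ * _); apply: eq_bigr => w _.
by rewrite eZ /term prodfV.
Qed.

(** [dynkin2] is divisible by X^2, so F^k [dynkin2] starts in degree k + 2: in degree m + 1 only k <
    m matters, that is, words of at most m + 1 blocks. *)
Let comp_dynkin2 m : (fps_comp (log2_coef K) F * dynkin2 s t u v) m.+1 =
  \sum_(k < m) log2_coef K k * (F ^+ k * dynkin2 s t u v) m.+1.
Proof.
set Q := fpsC d * (sc (s + t) (fps_exp K) * sc s (fps_phi K) -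
  sc s (fps_exp K) * sc t (fps_phi K)).
have E f : f * dynkin2 s t u v = fpsX K * (fpsX K * (f * Q)).
  by rewrite /dynkin2 /Q /d; ring.
rewrite E fpsXM; case: m => [|m]; first by rewrite fpsXM0 big_ord0.
rewrite fpsXM fpsME.
under [RHS]eq_bigr => k _ do rewrite E !fpsXM fpsME mulr_sumr.
rewrite [RHS]exchange_big; apply: eq_bigr => i _ /=.
rewrite (@fps_comp_wide _ _ _ i m) //; last by rewrite -ltnS.
by rewrite mulr_suml; apply: eq_bigr => k _; rewrite mulrA.
Qed.

Lemma affine_bch_degree m : n = m.+1 -> e (bch m.+1 x y) = bch_fps s t u v m.
Proof.
move=> nm; rewrite -[in LHS]nm e_bchE nm.
rewrite big_nat_recl // expr2 mulrNN mulr1 divr1 mul1r D1E ?nm //.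
have -> : \sum_(1 <= i < m.+1) (-1) ^+ i.+2 / i.+1%:R * D i.+1 m.+1 =
    (fps_comp (log2_coef K) F * dynkin2 s t u v) m.+1.
  rewrite comp_dynkin2 big_add1 big_mkord; apply: eq_bigr => k _.
  by rewrite DE ?nm // /log2_coef !exprS; congr (_ * _); congr (_ / _); ring.
(* [theta] multiplies degree m + 1 by m + 1, which cancels 1/n; the factor X accounts for the shift
   to degree m. *)
rewrite -fpsDE -bch_fps_dynkin /theta fpsXM -(mulr_natl (bch_fps s t u v m) m.+1) mulrA mulVf ?mul1r //.
Qed.
End Degree.

Lemma affine_bch m : e (bch m.+1 x y) = bch_fps s t u v m.
Proof. exact: (@affine_bch_degree m.+1). Qed.
End AffineBch.

(** * Geometrically bounded series *)

Section Geometric.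
Variable R : realType.
Implicit Types (f g : fps R) (K q x : R).

Definition geom_bounded K q f := forall n, `|f n| <= K * q ^+ n.

Lemma geom_bounded_ge0 K q f : geom_bounded K q f -> 0 <= K.
Proof. by move=> /(_ 0%N); rewrite expr0 mulr1; apply: le_trans. Qed.

Lemma geom_bounded_le K q K' q' f : K <= K' -> 0 <= q -> q <= q' ->
  geom_bounded K q f -> geom_bounded K' q' f.
Proof.
move=> KK q0 qq fb n; apply: (le_trans (fb n)).
by apply: ler_pM => //; rewrite ?exprn_ge0 ?(geom_bounded_ge0 fb) // lerXn2r // nnegrE (le_trans q0).
Qed.

Lemma geom_bounded_cvg0 K q f : 0 <= q -> q < 1 -> geom_bounded K q f ->
  f @ \oo --> (0 : R).
Proof.
move=> q0 q1 fb.
have cg c : (fun n => c * q ^+ n) @ \oo --> (0 : R).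
  by apply: (@cvg_geometric _ c q); rewrite ger0_norm.
apply: (@squeeze_cvgr _ _ _ _ (fun n => - K * q ^+ n) (fun n => K * q ^+ n)) => //.
by near=> n; rewrite mulNr -ler_norml.
Unshelve. all: by end_near. Qed.

Lemma geom_bounded_is_cvg K q f : 0 <= q -> q < 1 -> geom_bounded K q f ->
  cvgn (series f).
Proof.
move=> q0 q1 fb; apply: normed_cvg.
apply: (@series_le_cvg _ _ (geometric K q)) => [n|n|n|] //=.
  by rewrite mulr_ge0 ?exprn_ge0 ?(geom_bounded_ge0 fb).
by apply: is_cvg_geometric_series; rewrite ger0_norm.
Qed.

Lemma geom_boundedD K K' q f g : geom_bounded K q f -> geom_bounded K' q g ->
  geom_bounded (K + K') q (f + g).
Proof.
by move=> fb gb n; rewrite fpsDE mulrDl (le_trans (ler_normD _ _)) // lerD.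
Qed.

Lemma geom_boundedC c K q f : geom_bounded K q f -> geom_bounded (`|c| * K) q (fpsC c * f).
Proof. by move=> fb n; rewrite fpsCM normrM -mulrA ler_wpM2l. Qed.

Lemma geom_bounded_conv K K' q f g n : geom_bounded K q f -> geom_bounded K' q g ->
  `|(f * g) n| <= K * K' * n.+1%:R * q ^+ n.
Proof.
move=> fb gb; rewrite fpsME (le_trans (ler_norm_sum _ _ _)) //.
apply: (@le_trans _ _ (\sum_(i < n.+1) K * K' * q ^+ n)).
  apply: ler_sum => i _; rewrite normrM (le_trans (ler_pM _ _ (fb _) (gb _))) //.
  by rewrite mulrACA -exprD subnKC // -ltnS.
by rewrite sumr_const card_ord -[X in X <= _]mulr_natr mulrAC.
Qed.

(** The n + 1 terms of the convolution are absorbed by n + 1 <= 2^n, at the price of doubling the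
    ratio. *)
Lemma geom_boundedM K K' q f g : 0 <= q ->
  geom_bounded K q f -> geom_bounded K' q g -> geom_bounded (K * K') (2 * q) (f * g).
Proof.
move=> q0 fb gb n; apply: (le_trans (geom_bounded_conv _ fb gb)).
rewrite exprMn -mulrA; apply: ler_wpM2l.
  by rewrite mulr_ge0 ?(geom_bounded_ge0 fb) ?(geom_bounded_ge0 gb).
apply: ler_wpM2r; first exact: exprn_ge0.
by rewrite -natrX ler_nat ltn_expl.
Qed.

Lemma bernoulli_ineq (d : R) n : 0 <= d -> 1 + n%:R * d <= (1 + d) ^+ n.
Proof.
move=> d0; elim: n => [|n IH]; first by rewrite mul0r addr0 expr0.
rewrite exprS; apply: (@le_trans _ _ ((1 + d) * (1 + n%:R * d))); last first.
  by rewrite ler_wpM2l // addr_ge0.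
rewrite -natr1 -subr_ge0.
have -> : (1 + d) * (1 + n%:R * d) - (1 + (n%:R + 1) * d) = n%:R * d ^+ 2 by ring.
by rewrite mulr_ge0 ?exprn_ge0.
Qed.

Lemma cvg_natM_exp q : 0 <= q -> q < 1 -> (fun n => n%:R * q ^+ n) @ \oo --> (0 : R).
Proof.
rewrite le_eqVlt => /predU1P[<- _|q0 q1].
  rewrite (_ : (fun n => _) = fun=> 0); first exact: cvg_cst.
  by apply/funext => -[|n]; rewrite ?mul0r // expr0n mulr0.
set r := (1 + q) / 2.
have r1 : r < 1 by rewrite /r; lra.
have qr : q < r by rewrite /r; lra.
have r0 : 0 < r by lra.
set d := r / q - 1.
have d0 : 0 < d by rewrite /d subr_gt0 ltr_pdivlMr // mul1r.
apply: (@geom_bounded_cvg0 d^-1 r) => // [|n]; first exact: ltW.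
have -> : r = q * (1 + d) by rewrite /d; field; rewrite gt_eqF.
rewrite ger0_norm; last by rewrite mulr_ge0 ?exprn_ge0 // ltW.
rewrite exprMn ler_pdivlMl // mulrCA mulrA mulrC ler_wpM2l ?exprn_ge0 1?ltW //.
by apply: lt_le_trans (bernoulli_ineq n (ltW d0)); rewrite ltrDr ltr01.
Qed.

(** The partial sums of the product and the product of the partial sums differ by [diff]. The bounds
    on f and on the tails of g make it O(N q^N). *)
Lemma cauchy_product K K' q f g (a b : R) : 0 <= q -> q < 1 ->
  geom_bounded K q f -> geom_bounded K' q g ->
  series f @ \oo --> a -> series g @ \oo --> b -> series (f * g) @ \oo --> a * b.
Proof.
move=> q0 q1 fb gb fa gb'.
set v := series g.
have prodE N : series (f * g) N = \sum_(i < N) f i * v (N - i)%N.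
  elim: N => [|N IH]; first by rewrite /series /= big_geq // big_ord0.
  rewrite /series /= big_nat_recr //= -[\sum_(0 <= k < N) _]/(series (f * g) N) IH.
  have -> : \sum_(i < N.+1) f i * v (N.+1 - i)%N =
      \sum_(i < N.+1) f i * v (N - i)%N + (f * g) N.
    rewrite fpsME -big_split; apply: eq_bigr => i _.
    by rewrite subSn ?(ltnSE (ltn_ord i)) // /v /series /= big_nat_recr //= mulrDr.
  by rewrite big_ord_recr /= subnn {3}/v /series /= [X in f N * X]big_geq // mulr0 addr0.
(* With the denominator 1 - q cleared, the tail estimate goes through by induction on the number of
   terms. *)
have tail M k : (1 - q) * `|v (M + k)%N - v M| <= K' * q ^+ M * (1 - q ^+ k).
  elim: k => [|k IH]; first by rewrite addn0 subrr normr0 mulr0 expr0 subrr mulr0.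
  have -> : v (M + k.+1)%N - v M = (v (M + k)%N - v M) + g (M + k)%N.
    by rewrite addnS /v /series /= big_nat_recr //=; ring.
  apply: (@le_trans _ _ ((1 - q) * (`|v (M + k)%N - v M| + K' * q ^+ (M + k)))).
    apply: ler_wpM2l; first by rewrite subr_ge0 ltW.
    by rewrite (le_trans (ler_normD _ _)) // lerD2l.
  rewrite mulrDr (le_trans (lerD IH (lexx _))) //.
  by rewrite exprD exprS le_eqVlt; apply/orP; left; apply/eqP; ring.
have tail' M N : (M <= N)%N -> `|v N - v M| <= K' / (1 - q) * q ^+ M.
  move=> MN; have := tail M (N - M)%N; rewrite subnKC // => h.
  rewrite mulrAC ler_pdivlMr ?subr_gt0 // mulrC (le_trans h) // ler_piMr //.
    by rewrite mulr_ge0 ?exprn_ge0 ?(geom_bounded_ge0 gb).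
  by rewrite lerBlDr lerDl exprn_ge0.
set diff := fun N => \sum_(i < N) f i * (v N - v (N - i)%N).
have diffE N : series (f * g) N = series f N * v N - diff N.
  rewrite prodE seriesEord mulr_suml -sumrB; apply: eq_bigr => i _; ring.
have diff0 : diff @ \oo --> (0 : R).
  have c0 : (fun N => K * (K' / (1 - q)) * (N%:R * q ^+ N)) @ \oo --> (0 : R).
    by rewrite -(mulr0 (K * (K' / (1 - q)))); apply: cvgMl_tmp; exact: cvg_natM_exp.
  apply: (@squeeze_cvgr _ _ _ _ (fun N => - (K * (K' / (1 - q)) * (N%:R * q ^+ N)))
    (fun N => K * (K' / (1 - q)) * (N%:R * q ^+ N))) => //; last first.
    by rewrite -oppr0; apply: cvgN.
  near=> N; rewrite -ler_norml /diff (le_trans (ler_norm_sum _ _ _)) //.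
  apply: (@le_trans _ _ (\sum_(i < N) K * (K' / (1 - q)) * q ^+ N)).
    apply: ler_sum => i _; rewrite normrM.
    rewrite (le_trans (ler_pM _ _ (fb _) (tail' _ _ (leq_subr _ _)))) //.
    by rewrite mulrACA -exprD subnKC // ltnW.
  by rewrite sumr_const card_ord -[X in X <= _]mulr_natl mulrCA.
rewrite (_ : series (f * g) = fun N => series f N * v N - diff N); last exact/funext.
by rewrite -[a * b]subr0; apply: cvgB => //; apply: cvgM.
Unshelve. all: by end_near. Qed.

(** The left side majorizes the recursion [fpsinvE] under the induction hypothesis; as a finite
    geometric sum in 1 + K it does not exceed (q (1 + K))^(n + 1). *)
Lemma geom_bound_inv_sum K q n : 
  \sum_(i < n.+1) K * q ^+ i.+1 * (q * (1 + K)) ^+ (n - i) =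
  (q * (1 + K)) ^+ n.+1 - q ^+ n.+1.
Proof.
have -> : (q * (1 + K)) ^+ n.+1 - q ^+ n.+1 = q ^+ n.+1 * ((1 + K) ^+ n.+1 - 1).
  by rewrite exprMn; ring.
rewrite [in RHS]subrX1 (_ : 1 + K - 1 = K); last by ring.
rewrite [in RHS]mulrA mulr_sumr [RHS](reindex_inj rev_ord_inj) /=.
apply: eq_bigr => i _; have lein : (i <= n)%N by rewrite -ltnS.
rewrite subSS exprMn (_ : q ^+ n.+1 = q ^+ i.+1 * q ^+ (n - i)); first by ring.
by rewrite -exprD addSn subnKC.
Qed.

Lemma geom_bounded_inv K q f : 0 <= q -> f 0%N = 1 -> geom_bounded K q f ->
  geom_bounded 1 (q * (1 + K)) (fpsinv f).
Proof.
move=> q0 f0 fb n; rewrite mul1r; elim/ltn_ind: n => -[|n] IH.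
  by rewrite fpsinv0 // expr0 normr1.
rewrite fpsinvE // normrN (le_trans (ler_norm_sum _ _ _)) //.
apply: (@le_trans _ _ (\sum_(i < n.+1) K * q ^+ i.+1 * (q * (1 + K)) ^+ (n - i))).
  apply: ler_sum => i _; rewrite normrM ler_pM // IH //.
  by rewrite ltnS leq_subr.
by rewrite geom_bound_inv_sum lerBlDr lerDl exprn_ge0.
Qed.
End Geometric.

(** * The sum of the series near 0 *)

Section BchSum.
Variable R : realType.
Implicit Types (f g : fps R) (K q x s t u v : R).

Notation X := (fpsX R).
Notation E c := (sc c (fps_exp R)).
Notation Phi c := (sc c (fps_phi R)).

Definition expm1_div x : R := if x == 0 then 1 else (expR x - 1) / x.

Lemma expm1_div_gt0 x : 0 < expm1_div x.
Proof.
rewrite /expm1_div; case: eqP => [//|/eqP x0].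
case: (ltrgt0P x) x0 => // [x0 _|x0 _]; first by rewrite divr_gt0 // subr_gt0 expR_gt1.
by rewrite nmulr_rgt0 ?invr_lt0 // subr_lt0 expR_lt1.
Qed.

Lemma fps_exp_cvg x : series (E x) @ \oo --> expR x.
Proof.
have -> : (E x : nat -> R) = exp_coeff x.
  by apply/funext => n; rewrite exp_coeffE /sc mulrC.
exact: is_cvg_series_exp_coeff.
Qed.

Lemma seriesS (f : nat -> R) n : series f n.+1 = series f n + f n.
Proof. by rewrite /series /= big_nat_recr. Qed.

Lemma fps1_cvg : series (1 : fps R) @ \oo --> (1 : R).
Proof.
rewrite -(cvg_shiftS (series (1 : fps R))) (_ : (fun n => _) = fun=> (1 : R)).
  exact: (@cvg_cst R).
by apply/funext => n; rewrite /series /= big_nat_recl // big1 ?addr0.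
Qed.

Lemma series_fpsX f n : series (X * f) n.+1 = series f n.
Proof.
elim: n => [|n IH]; first by rewrite seriesS fpsXM0 /series /= !big_geq // addr0.
by rewrite [LHS]seriesS IH fpsXM [RHS]seriesS.
Qed.

Lemma series_fpsC c f : series (fpsC c * f) = fun n => c * series f n.
Proof.
apply/funext => n; rewrite /series /= mulr_sumr; apply: eq_bigr => i _.
by rewrite fpsCM.
Qed.

Lemma fps_phi_cvg x : series (Phi x) @ \oo --> expm1_div x.
Proof.
have e n : 1 + x * series (Phi x) n = series (E x) n.+1.
  rewrite fps_expE scD sc1 scM scX -mulrA [fpsC x * _]mulrC -mulrA.
  elim: n => [|n IH]; first by rewrite seriesS /series /= !big_geq // mulr0 addr0 add0r fpsDE fpsXM0 addr0.
  by rewrite [RHS]seriesS -IH seriesS fpsDE fpsXM [_ * fpsC x]mulrC fpsCM fps1E /=; ring.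
rewrite /expm1_div; case: eqP => [->|/eqP x0].
  rewrite -(cvg_shiftS (series (Phi 0))) (_ : (fun n => _) = fun=> (1 : R)); first exact: (@cvg_cst R).
  apply/funext => n; rewrite /series /= big_nat_recl // big1 ?addr0 ?/sc.
    by rewrite expr0 mul1r /fps_phi invr1.
  by move=> i _; rewrite expr0n mul0r.
have -> : series (Phi x) = fun n => (series (E x) n.+1 - 1) / x.
  by apply/funext => n; rewrite -e addrC addKr mulrC mulKf.
apply: cvgMr_tmp; apply: cvgB; last exact: cvg_cst.
by rewrite (cvg_shiftS (series (E x))); exact: fps_exp_cvg.
Qed.

(** Any ratio q is allowed: with y = |x| / q, each y^n / n! is at most e^y. *)
Lemma fps_exp_bounded x q : 0 < q -> exists K, geom_bounded K q (E x).
Proof.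
move=> q0; exists (expR (`|x| / q)) => n.
rewrite /sc /fps_exp normrM normrX.
have -> : `|x| ^+ n = (`|x| / q) ^+ n * q ^+ n by rewrite -exprMn divfK // gt_eqF.
rewrite mulrAC; apply: ler_wpM2r; first by rewrite exprn_ge0 // ltW.
have y0 : 0 <= `|x| / q by rewrite divr_ge0 // ltW.
rewrite ger0_norm ?invr_ge0 //; case: n => [|n].
  by rewrite expr0 mul1r invr1 -[1]expR0 ler_expR.
by apply: le_trans (expR_ge1Dxn n y0); rewrite lerDr.
Qed.

Lemma fps_phi_bounded x q : 0 < q -> exists K, geom_bounded K q (Phi x).
Proof.
move=> q0; have [K Kb] := fps_exp_bounded x q0; exists K => n.
apply: le_trans (Kb n); rewrite /sc /fps_exp /fps_phi !normrM ler_wpM2l //.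
rewrite !ger0_norm ?invr_ge0 // lef_pV2 ?posrE ?ltr0n ?fact_gt0 //.
by rewrite ler_nat factS leq_pmull.
Qed.

Lemma fps_phi_small x q : `|x| <= q -> geom_bounded 1 q (Phi x).
Proof.
move=> xq n; rewrite /sc /fps_phi normrM normrX mul1r.
apply: (@le_trans _ _ (`|x| ^+ n)); last by rewrite lerXn2r // nnegrE (le_trans _ xq).
rewrite ler_piMr ?exprn_ge0 // ger0_norm ?invr_ge0 // invf_le1 ?ltr0n ?fact_gt0 //.
by rewrite ler1n fact_gt0.
Qed.

Lemma fps_phi0 x : Phi x 0%N = 1.
Proof. by rewrite /sc expr0 mul1r /fps_phi invr1. Qed.

Lemma series_fpsD f g : series (f + g) = fun n => series f n + series g n.
Proof. by apply/funext => n; rewrite /series /= -big_split. Qed.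

Definition bch_sum s t u v : R :=
  (u * expm1_div s + v * (expR s * expm1_div t)) / expm1_div (s + t).

Lemma bch_fps_cvg s t u v : `|s| <= 1 / 16 -> `|t| <= 1 / 16 ->
  series (bch_fps s t u v) @ \oo --> bch_sum s t u v.
Proof.
(* From |s + t| <= 1/8 = q, [fps_phi_small] bounds phi((s + t) z) with constant 1, so inversion only
   doubles the ratio: 2 q = 1/4 < 1. *)
move=> sl tl; pose q : R := 1 / 8.
have q0 : 0 < q by rewrite /q; lra.
have [K1 b1] := fps_phi_bounded s q0.
have [K2 b2] := fps_exp_bounded s q0.
have [K3 b3] := fps_phi_bounded t q0.
have b4 := geom_boundedM (ltW q0) b2 b3.
have b5 : geom_bounded (`|u| * K1) (2 * q) (fpsC u * Phi s).
  apply: geom_boundedC; apply: geom_bounded_le b1 => //; first exact: ltW.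
  by rewrite /q; lra.
have b6 : geom_bounded (`|u| * K1 + `|v| * (K2 * K3)) (2 * q) (bch_fps_num s t u v).
  by apply: geom_boundedD => //; apply: geom_boundedC.
have b7 : geom_bounded 1 q (Phi (s + t)).
  by apply: fps_phi_small; rewrite (le_trans (ler_normD _ _)) // /q; lra.
have b8 := geom_bounded_inv (ltW q0) (fps_phi0 (s + t)) b7.
rewrite (_ : q * (1 + 1) = 2 * q) in b8; last by ring.
have q2 : 0 <= 2 * q by rewrite /q; lra.
have q2' : 2 * q < 1 by rewrite /q; lra.
have cinv : series (fpsinv (Phi (s + t))) @ \oo --> (expm1_div (s + t))^-1.
  have c := geom_bounded_is_cvg q2 q2' b8.
  suff -> : (expm1_div (s + t))^-1 = limn (series (fpsinv (Phi (s + t)))) by [].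
  have b7' : geom_bounded 1 (2 * q) (Phi (s + t)).
    by apply: geom_bounded_le b7; rewrite ?(ltW q0) // /q; lra.
  have p := cauchy_product q2 q2' b7' b8 (@fps_phi_cvg (s + t)) c.
  rewrite fpsMV ?fps_phi0 // in p.
  have p1 : series (1 : fps R) @ \oo --> (1 : R) by exact: fps1_cvg.
  have := cvg_unique _ p p1 => /(_ (@norm_hausdorff _ _)) pe.
  by rewrite -[LHS]mulr1 -pe mulKf // gt_eqF // expm1_div_gt0.
apply: (cauchy_product q2 q2' b6 b8) cinv.
rewrite /bch_fps_num series_fpsD !series_fpsC; apply: cvgD.
  by apply: cvgMl_tmp; exact: fps_phi_cvg.
apply: cvgMl_tmp; apply: (cauchy_product _ _ b2 b3); rewrite ?(ltW q0) //.
- by rewrite /q; lra.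
- exact: fps_exp_cvg.
- exact: fps_phi_cvg.
Qed.
End BchSum.

(** * Analytic functions of several variables *)

Section Homogeneous.
Variables (R : realType) (m : nat).
Notation vec := ('I_m -> R).
Implicit Types (h p x : vec) (N r : R).

(* [homog n H N]: [H] is a homogeneous polynomial of degree [n] with a presentation
   whose coefficients have absolute values summing to at most [N]. *)
Inductive homog : nat -> (vec -> R) -> R -> Prop :=
| homog0 n : homog n (fun=> 0) 0
| homog_monom (a : {ffun 'I_m -> nat}) (c : R) :
    homog (\sum_i a i)%N (fun h => c * \prod_i h i ^+ a i) `|c|
| homogD n H H' N N' : homog n H N -> homog n H' N' ->
    homog n (fun h => H h + H' h) (N + N')
| homog_le n H N N' : homog n H N -> N <= N' -> homog n H N'.

Lemma homog_ge0 n H N : homog n H N -> 0 <= N.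
Proof.
elim=> {n H N} // [n H H' N N' _ ? _ ?|n H N N' _]; first exact: addr_ge0.
exact: le_trans.
Qed.

Lemma homogM n n' H H' N N' : homog n H N -> homog n' H' N' ->
  homog (n + n') (fun h => H h * H' h) (N * N').
Proof.
move=> HH HH'; elim: HH => {n H N} [n|a c|n H1 H2 N1 N2 _ IH1 _ IH2|n H N M HN IH NM].
- rewrite (_ : (fun h => 0 * H' h) = fun=> 0) ?mul0r; first exact: homog0.
  by apply/funext => h; rewrite mul0r.
- elim: HH' => {n' H' N'} [n|b d|n H1 H2 N1 N2 _ IH1 _ IH2|n H N M HN IH NM].
  + rewrite (_ : (fun h => _ * 0) = fun=> 0) ?mulr0; first exact: homog0.
    by apply/funext => h; rewrite mulr0.
  + rewrite -normrM; have := homog_monom [ffun i => a i + b i]%N (c * d).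
    rewrite (_ : (\sum_i _)%N = (\sum_i a i + \sum_i b i)%N); last first.
      by rewrite -big_split; apply: eq_bigr => i _; rewrite ffunE.
    congr homog; apply/funext => h; rewrite mulrACA -big_split; congr (_ * _).
    by apply: eq_bigr => i _; rewrite ffunE exprD.
  + rewrite mulrDr; have := homogD IH1 IH2; congr homog.
    by apply/funext => h; rewrite mulrDr.
  + by apply: homog_le IH _; rewrite ler_wpM2l.
- rewrite mulrDl; have := homogD IH1 IH2; congr homog.
  by apply/funext => h; rewrite mulrDl.
- by apply: homog_le IH _; rewrite ler_wpM2r // (homog_ge0 HH').
Qed.

Lemma homog_const c : homog 0 (fun=> c) `|c|.
Proof.
have := homog_monom [ffun i => 0%N] c.
rewrite (_ : (\sum_i _)%N = 0%N); last by rewrite big1 // => i _; rewrite ffunE.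
congr homog; apply/funext => h; rewrite big1 ?mulr1 // => i _.
by rewrite ffunE expr0.
Qed.

Lemma homogZ c n H N : homog n H N -> homog n (fun h => c * H h) (`|c| * N).
Proof. by move=> HH; exact: (homogM (homog_const c) HH). Qed.

Lemma homog_sum I (s : seq I) n (H : I -> vec -> R) (N : I -> R) :
  (forall i, homog n (H i) (N i)) ->
  homog n (fun h => \sum_(i <- s) H i h) (\sum_(i <- s) N i).
Proof.
move=> HH; elim: s => [|i s IH].
  rewrite big_nil (_ : (fun h => _) = fun=> 0); first exact: homog0.
  by apply/funext => h; rewrite big_nil.
rewrite big_cons; have := homogD (HH i) IH; congr homog.
by apply/funext => h; rewrite big_cons.
Qed.

Definition linear_form (l : vec) x : R := \sum_i l i * x i.

Lemma linear_formD l p h : linear_form l (fun i => p i + h i) = linear_form l p + linear_form l h.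
Proof. by rewrite -big_split; apply: eq_bigr => i _; rewrite mulrDr. Qed.

Lemma linear_form_bound l h r : (forall i, `|h i| <= r) ->
  `|linear_form l h| <= (\sum_i `|l i|) * r.
Proof.
move=> hr; rewrite (le_trans (ler_norm_sum _ _ _)) // mulr_suml; apply: ler_sum => i _.
by rewrite normrM ler_wpM2l.
Qed.

Lemma homog_linear l : homog 1 (linear_form l) (\sum_i `|l i|).
Proof.
apply: homog_sum => i; have := homog_monom [ffun j => (j == i : nat)] (l i).
rewrite (_ : (\sum_j _)%N = 1%N); last first.
  rewrite (bigD1 i) //= ffunE eqxx big1 // => j ji.
  by rewrite ffunE (negbTE ji).
congr homog; apply/funext => h; congr (_ * _).
rewrite (bigD1 i) //= ffunE eqxx expr1 big1 ?mulr1 // => j ji.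
by rewrite ffunE (negbTE ji) expr0.
Qed.

Lemma homogX H N n : homog 1 H N -> homog n (fun h => H h ^+ n) (N ^+ n).
Proof.
move=> HH; elim: n => [|n IH].
  rewrite expr0; have := homog_const 1; rewrite normr1; congr homog.
rewrite exprS -add1n; have := homogM HH IH; congr homog.
by apply/funext => h; rewrite exprS.
Qed.

Lemma prod_exp_bound (a : 'I_m -> nat) h r : 0 <= r -> (forall i, `|h i| <= r) ->
  \prod_i `|h i| ^+ a i <= r ^+ (\sum_i a i).
Proof.
move=> r0 hr; rewrite expr_sum; apply: ler_prod => i _; rewrite exprn_ge0 //=.
by rewrite lerXn2r // nnegrE.
Qed.

Lemma homog_bound n H N h r : homog n H N -> 0 <= r -> (forall i, `|h i| <= r) ->
  `|H h| <= N * r ^+ n.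
Proof.
move=> HH r0 hr; elim: HH => {n H N} [n|a c|n H H' N N' _ IH _ IH'|n H N N' _ IH NN].
- by rewrite normr0 mul0r.
- rewrite normrM ler_wpM2l // normr_prod; under eq_bigr => i _ do rewrite normrX.
  exact: prod_exp_bound.
- by rewrite mulrDl (le_trans (ler_normD _ _)) // lerD.
- by rewrite (le_trans IH) // ler_wpM2r // exprn_ge0.
Qed.

Lemma homog_degree0 n H N h h' : homog n H N -> n = 0%N -> H h = H h'.
Proof.
elim=> {n H N} // [a c /eqP|n H H' N N' _ IH _ IH' n0]; last by rewrite IH // IH'.
rewrite sum_nat_eq0 => /forallP a0; congr (_ * _); apply: eq_bigr => i _.
by have /eqP -> := a0 i; rewrite !expr0.
Qed.

(** Passes to the coefficient families of [analytic_at]: N survives as a bound after absolute values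
    are taken everywhere. *)
Lemma homog_coef n H N : homog n H N -> exists c : ('I_m -> nat) -> R,
  (forall h, H h = mpow_part c h n) /\
  (forall h r, 0 <= r -> (forall i, `|h i| <= r) ->
    mpow_part (fun a => `|c a|) (fun i => `|h i|) n <= N * r ^+ n).
Proof.
elim=> {n H N} [n|a c|n H H' N N' _ [c [cE cb]] _ [c' [cE' cb']]|n H N N' _ [c [cE cb]] NN].
- exists (fun=> 0); split=> [h|h r r0 hr]; rewrite /mpow_part ?big1 ?mul0r // => b _;
  by rewrite ?normr0 mul0r.
- set n := (\sum_i a i)%N.
  have an i : (a i < n.+1)%N by rewrite ltnS /n (bigD1 i) //= leq_addr.
  pose b0 : {ffun 'I_m -> 'I_n.+1} := [ffun i => inord (a i)].
  have b0E i : b0 i = a i :> nat by rewrite ffunE inordK.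
  have mono (d : R) h : mpow_part (fun b => if [forall i, b i == a i] then d else 0) h n =
      d * \prod_i h i ^+ a i.
    rewrite /mpow_part (bigD1 b0) /=; last by apply/eqP/eq_bigr => i _; rewrite b0E.
    rewrite (_ : [forall i, _] = true); last by apply/forallP => i; rewrite b0E.
    rewrite [X in _ + X]big1 ?addr0.
      by congr (_ * _); apply: eq_bigr => i _; rewrite b0E.
    move=> b /andP[_ bb]; case: ifPn => [/forallP e|]; last by rewrite mul0r.
    case/eqP: bb; apply/ffunP => i; apply: val_inj; rewrite /= b0E.
    exact/eqP.
  exists (fun b => if [forall i, b i == a i] then c else 0); split=> [h|h r r0 hr].
    by rewrite mono.
  rewrite (_ : (fun b => _) = fun b => if [forall i, b i == a i] then `|c| else 0).
    by rewrite mono ler_wpM2l // prod_exp_bound.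
  by apply/funext => b; case: ifP; rewrite ?normr0.
- exists (fun a => c a + c' a); split=> [h|h r r0 hr].
    rewrite cE cE' /mpow_part -big_split; apply: eq_bigr => a _.
    by rewrite mulrDl.
  rewrite mulrDl; apply: le_trans (lerD (cb h r r0 hr) (cb' h r r0 hr)).
  rewrite /mpow_part -big_split /=; apply: ler_sum => a _.
  by rewrite -mulrDl ler_wpM2r ?ler_normD // prodr_ge0.
- exists c; split=> // h r r0 hr; apply: le_trans (cb h r r0 hr) _.
  by rewrite ler_wpM2r // exprn_ge0.
Qed.
End Homogeneous.

Section Analytic.
Variables (R : realType) (m : nat).
Notation vec := ('I_m -> R).
Implicit Types (f g : vec -> R) (h p x l : vec) (N r : R).

(* A form of [analytic_at] whose geometric bounds on the homogeneous parts make it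
   stable under products and inverses. *)
Definition tame_at f p := exists (H : vec -> fps R) (K rho r : R),
  [/\ 0 <= rho, 0 < r, forall n, homog n (fun h => H h n) (K * rho ^+ n) &
    forall h, (forall i, `|h i| < r) -> series (H h) @ \oo --> f (fun i => p i + h i)].

Lemma homog_geom_bounded (H : vec -> fps R) K rho r h :
  (forall n, homog n (fun h => H h n) (K * rho ^+ n)) -> 0 <= r ->
  (forall i, `|h i| <= r) -> geom_bounded K (rho * r) (H h).
Proof.
by move=> HH r0 hr n; rewrite exprMn mulrA; exact: homog_bound (HH n) r0 hr.
Qed.

Let radius rho c : 0 <= rho -> 0 < c -> exists2 r : R, 0 < r & rho * r <= c.
Proof.
move=> r0 c0; exists (c / (rho + 1)); first by rewrite divr_gt0 // ltr_wpDl.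
have d0 : 0 < rho + 1 by rewrite ltr_wpDl.
rewrite mulrCA ger_pMr // ler_pdivrMr // mul1r; lra.
Qed.

Let half_gt0 : 0 < 2^-1 :> R. Proof. lra. Qed.

Lemma tame_analytic f p : tame_at f p -> analytic_at f p.
Proof.
move=> [H [K [rho [r [rho0 r0 HH Hf]]]]].
have [c cP] := choice (fun n => homog_coef (HH n)).
have [r1 r10 r1h] := radius rho0 half_gt0.
(* The families chosen degree by degree are glued along the total degree of the multi-index; the
   radius makes the geometric ratio at most 1/2. *)
exists (fun a => c (\sum_i a i)%N a), (Num.min r r1); split; first by rewrite lt_min r0.
move=> h hr.
have part_eq (d : nat -> ('I_m -> nat) -> R) h' n :
    mpow_part (fun a => d (\sum_i a i)%N a) h' n = mpow_part (d n) h' n.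
  by apply: eq_bigr => a /eqP ->.
have hr1 i : `|h i| <= r1 by have := hr i; rewrite lt_min => /andP[_ /ltW].
have hr0 i : `|h i| < r by have := hr i; rewrite lt_min => /andP[].
split.
  apply: (@geom_bounded_is_cvg _ K (2^-1)) => [||n]; [lra|lra|].
  rewrite (part_eq (fun n a => `|c n a|)) ger0_norm; last first.
    by rewrite sumr_ge0 // => a _; rewrite mulr_ge0 // prodr_ge0.
  have [_ b] := cP n; apply: le_trans (b h r1 (ltW r10) hr1) _.
  rewrite -mulrA -exprMn ler_wpM2l //.
    by have := homog_ge0 (HH 0%N); rewrite expr0 mulr1.
  by rewrite lerXn2r // nnegrE ?mulr_ge0 // ltW.
rewrite (_ : mpow_part _ h = H h); first exact: Hf.
by apply/funext => n; rewrite (part_eq c); have [-> _] := cP n.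
Qed.

Lemma tame_ext f g p r : 0 < r ->
  (forall h, (forall i, `|h i| < r) -> f (fun i => p i + h i) = g (fun i => p i + h i)) ->
  tame_at f p -> tame_at g p.
Proof.
move=> r0 fg [H [K [rho [r' [rho0 r'0 HH Hf]]]]].
exists H, K, rho, (Num.min r r'); split=> //; first by rewrite lt_min r0.
move=> h hr; rewrite -fg; last by move=> i; have := hr i; rewrite lt_min => /andP[].
by apply: Hf => i; have := hr i; rewrite lt_min => /andP[].
Qed.

Lemma tameD f g p : tame_at f p -> tame_at g p -> tame_at (fun x => f x + g x) p.
Proof.
move=> [H [K [rho [r [rho0 r0 HH Hf]]]]] [H' [K' [rho' [r' [rho'0 r'0 HH' Hf']]]]].
exists (fun h => H h + H' h), (K + K'), (rho + rho'), (Num.min r r').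
have K0 : 0 <= K by have := homog_ge0 (HH 0%N); rewrite expr0 mulr1.
have K'0 : 0 <= K' by have := homog_ge0 (HH' 0%N); rewrite expr0 mulr1.
split; [exact: addr_ge0|by rewrite lt_min r0| |].
  move=> n; apply: homog_le (homogD (HH n) (HH' n)) _.
  by rewrite mulrDl lerD // ler_wpM2l // lerXn2r // ?nnegrE ?addr_ge0 // ?lerDl ?lerDr.
move=> h hr; rewrite series_fpsD; apply: cvgD.
  by apply: Hf => i; have := hr i; rewrite lt_min => /andP[].
by apply: Hf' => i; have := hr i; rewrite lt_min => /andP[].
Qed.

Lemma homog_conv (H H' : vec -> fps R) K K' rho n : 0 <= rho ->
  (forall n, homog n (fun h => H h n) (K * rho ^+ n)) ->
  (forall n, homog n (fun h => H' h n) (K' * rho ^+ n)) ->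
  homog n (fun h => (H h * H' h) n) (K * K' * (2 * rho) ^+ n).
Proof.
move=> rho0 HH HH'.
have K0 : 0 <= K by have := homog_ge0 (HH 0%N); rewrite expr0 mulr1.
have K'0 : 0 <= K' by have := homog_ge0 (HH' 0%N); rewrite expr0 mulr1.
apply: (@homog_le _ _ _ _ (\sum_(i < n.+1) K * rho ^+ i * (K' * rho ^+ (n - i)))).
  apply: homog_sum => i.
  by have := homogM (HH i) (HH' (n - i)%N); rewrite subnKC // -ltnS.
apply: (@le_trans _ _ (\sum_(i < n.+1) K * K' * rho ^+ n)).
  by apply: ler_sum => i _; rewrite mulrACA -exprD subnKC // -ltnS.
rewrite sumr_const card_ord -mulrnAr ler_wpM2l ?mulr_ge0 // exprMn -mulr_natl.
by rewrite ler_wpM2r ?exprn_ge0 // -natrX ler_nat ltn_expl.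
Qed.

Lemma tameM f g p : tame_at f p -> tame_at g p -> tame_at (fun x => f x * g x) p.
Proof.
move=> [H [K [rho1 [r [rho0 r0 HH Hf]]]]] [H' [K' [rho' [r' [rho'0 r'0 HH' Hf']]]]].
have K0 : 0 <= K by have := homog_ge0 (HH 0%N); rewrite expr0 mulr1.
have K'0 : 0 <= K' by have := homog_ge0 (HH' 0%N); rewrite expr0 mulr1.
set rho := rho1 + rho'; have rhoge0 : 0 <= rho by exact: addr_ge0.
have {}HH n : homog n (fun h => H h n) (K * rho ^+ n).
  by apply: homog_le (HH n) _; rewrite ler_wpM2l // lerXn2r // ?nnegrE // lerDl.
have {}HH' n : homog n (fun h => H' h n) (K' * rho ^+ n).
  by apply: homog_le (HH' n) _; rewrite ler_wpM2l // lerXn2r // ?nnegrE // lerDr.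
have [r1 r10 r1h] := radius rhoge0 half_gt0.
exists (fun h => H h * H' h), (K * K'), (2 * rho), (Num.min (Num.min r r') r1).
split; [exact: mulr_ge0|by rewrite !lt_min r0 r'0| |].
  by move=> n; exact: homog_conv.
move=> h hr.
have [hr1 hr2 hr3] : [/\ forall i, `|h i| < r, forall i, `|h i| < r' & forall i, `|h i| <= r1].
  by split=> i; have := hr i; rewrite !lt_min => /andP[/andP[? ?] ?] //; exact: ltW.
apply: (@cauchy_product _ K K' (rho * r1)); rewrite ?mulr_ge0 ?(ltW r10) //.
- by rewrite (le_lt_trans r1h) //; lra.
- exact: homog_geom_bounded HH (ltW r10) hr3.
- exact: homog_geom_bounded HH' (ltW r10) hr3.
- exact: Hf.
- exact: Hf'.
Qed.

Lemma tame_cst c p : tame_at (fun=> c) p.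
Proof.
exists (fun=> fpsC c), `|c|, 0, 1; split=> // [[|n]|h _].
- by rewrite expr0 mulr1; exact: homog_const.
- by rewrite expr0n mulr0; exact: homog0.
rewrite -(cvg_shiftS (series (fpsC c))) (_ : (fun n => _) = fun=> c); first exact: (@cvg_cst R).
by apply/funext => n; rewrite /series /= big_nat_recl // big1 ?addr0.
Qed.

Let homog_inv (H : vec -> fps R) K rho n : 0 <= rho -> (forall h, H h 0%N = 1) ->
  (forall n, homog n (fun h => H h n) (K * rho ^+ n)) ->
  homog n (fun h => fpsinv (H h) n) ((rho * (1 + K)) ^+ n).
Proof.
move=> rho0 H1 HH; elim/ltn_ind: n => -[|n] IH.
  rewrite (_ : (fun h => _) = fun=> 1).
    by have := @homog_const R m 1; rewrite normr1 expr0.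
  by apply/funext => h; rewrite fpsinv0.
rewrite (_ : (fun h => _) =
    fun h => -1 * \sum_(i < n.+1) H h i.+1 * fpsinv (H h) (n - i)%N); last first.
  by apply/funext => h; rewrite fpsinvE // mulN1r.
apply: (@homog_le _ _ _ _ (`|-1| * \sum_(i < n.+1) K * rho ^+ i.+1 * (rho * (1 + K)) ^+ (n - i))).
  apply: homogZ; apply: homog_sum => i.
  have lein : (i <= n)%N by rewrite -ltnS.
  have lt : (n - i < n.+1)%N by rewrite ltnS leq_subr.
  by have := homogM (HH i.+1) (IH _ lt); rewrite addSn subnKC.
by rewrite normrN1 mul1r geom_bound_inv_sum lerBlDr lerDl exprn_ge0.
Qed.

Let tameV1 f p : f p = 1 -> tame_at f p -> tame_at (fun x => (f x)^-1) p.
Proof.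
move=> fp1 [H [K [rho [r [rho0 r0 HH Hf]]]]].
(* The degree 0 part does not depend on h, and at h = 0 all other parts vanish, so it equals f p. *)
have H1 h : H h 0%N = 1.
  rewrite (homog_degree0 h (fun=> 0) (HH 0%N)) //.
  have c : series (H (fun=> 0)) @ \oo --> (H (fun=> 0) 0%N).
    rewrite -(cvg_shiftS (series _)) (_ : (fun n => _) = fun=> H (fun=> 0) 0%N); first exact: (@cvg_cst R).
    apply/funext => n; rewrite /series /= big_nat_recl // big1 ?addr0 // => i _.
    apply/eqP; rewrite -normr_le0.
    have := @homog_bound _ _ _ _ _ (fun=> 0) 0 (HH i.+1) (lexx _).
    by rewrite expr0n mulr0; apply => j; rewrite normr0.
  have := Hf (fun=> 0); rewrite [X in f X](_ : _ = p); last by apply/funext => i; rewrite addr0.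
  rewrite fp1 => c'; apply: (cvg_unique _ c (c' _)) => [|i]; first exact: norm_hausdorff.
  by rewrite normr0.
have K0 : 0 <= K by have := homog_ge0 (HH 0%N); rewrite expr0 mulr1.
have rK : 0 <= rho * (1 + K) by rewrite mulr_ge0 // addr_ge0.
have [r1 r10 r1h] := radius rK half_gt0.
have HI n := homog_inv n rho0 H1 HH.
exists (fun h => fpsinv (H h)), 1, (rho * (1 + K)), (Num.min r r1).
split=> //; first by rewrite lt_min r0.
  by move=> n; rewrite mul1r.
move=> h hr.
have [hr1 hr2] : (forall i, `|h i| < r) /\ (forall i, `|h i| <= r1).
  by split=> i; have := hr i; rewrite !lt_min => /andP[? ?] //; exact: ltW.
set q := rho * (1 + K) * r1; have q0 : 0 <= q by rewrite mulr_ge0 // ltW.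
have q1 : q < 1 by rewrite (le_lt_trans r1h) //; lra.
have b1 : geom_bounded K q (H h).
  apply: geom_bounded_le (homog_geom_bounded HH (ltW r10) hr2) => //.
    by rewrite mulr_ge0 // ltW.
  by rewrite /q -mulrA ler_wpM2l // ler_peMl ?(ltW r10) // lerDl.
have b2 : geom_bounded 1 q (fpsinv (H h)).
  by apply: (homog_geom_bounded (H := fun h => fpsinv (H h))) (ltW r10) hr2 => n; rewrite mul1r.
have c := geom_bounded_is_cvg q0 q1 b2.
have prod := cauchy_product q0 q1 b1 b2 (Hf h hr1) c.
rewrite fpsMV // in prod.
have p1 : series (1 : fps R) @ \oo --> (1 : R) by exact: fps1_cvg.
have pe : f (fun i => p i + h i) * limn (series (fpsinv (H h))) = 1.
  exact: (cvg_unique (@norm_hausdorff _ _) prod p1).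
suff -> : (f (fun i => p i + h i))^-1 = limn (series (fpsinv (H h))) by [].
rewrite -[LHS]mulr1 -pe mulKf //; apply/eqP => f0; move/eqP: pe.
by rewrite f0 mul0r eq_sym oner_eq0.
Qed.

Lemma tameV f p : f p != 0 -> tame_at f p -> tame_at (fun x => (f x)^-1) p.
Proof.
move=> fp0 tf.
have t1 : tame_at (fun x => (f p)^-1 * f x) p by apply: tameM => //; exact: tame_cst.
have := tameM (tame_cst (f p)^-1 p) (tameV1 (mulVf fp0) t1).
apply: (tame_ext ltr01) => h _.
by rewrite invfM invrK mulrA mulVf // mul1r.
Qed.

(** A one-variable expansion of g at l(p), with coefficients [gam], has the homogeneous parts
    [gam n] l(h)^n in several variables. *)
Lemma tame_comp (gam : fps R) (g : R -> R) l p K q r : 0 <= q -> 0 < r ->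
  geom_bounded K q gam ->
  (forall k, `|k| < r -> series (sc k gam) @ \oo --> g (linear_form l p + k)) ->
  tame_at (fun x => g (linear_form l x)) p.
Proof.
move=> q0 r0 gb gP; set La := \sum_i `|l i|.
have La0 : 0 <= La by exact: sumr_ge0.
have [r1 r10 r1h] := radius La0 (divr_gt0 r0 (ltr0Sn R 1)).
exists (fun h => sc (linear_form l h) gam), K, (q * La), r1; split=> //.
- exact: mulr_ge0.
- move=> n; rewrite (_ : (fun h => _) = fun h => gam n * linear_form l h ^+ n); last first.
    by apply/funext => h; rewrite /sc mulrC.
  apply: homog_le (homogZ (gam n) (homogX n (homog_linear l))) _.
  by rewrite exprMn mulrA ler_wpM2r // exprn_ge0.
- move=> h hr; rewrite linear_formD; apply: gP.
  apply: (le_lt_trans (linear_form_bound l (r := r1) _)) => [i|]; first exact: ltW.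
  by rewrite (le_lt_trans r1h) //; lra.
Qed.
End Analytic.

(** * Analyticity of the group law *)

Section AnalyticBch.
Variables (R : realType) (m : nat).
Notation vec := ('I_m -> R).
Implicit Types (p x l : vec).

Lemma tame_expR l p : tame_at (fun x => expR (linear_form l x)) p.
Proof.
set c := linear_form l p.
apply: (@tame_comp _ _ (fpsC (expR c) * fps_exp R) expR l p `|expR c| 1 1) => // [n|k _].
  rewrite expr1n mulr1 fpsCM normrM ler_piMr // /fps_exp ger0_norm ?invr_ge0 //.
  by rewrite invf_le1 ?ltr0n ?fact_gt0 // ler1n fact_gt0.
rewrite (_ : sc k _ = fpsC (expR c) * sc k (fps_exp R)); last first.
  by apply/funext => n; rewrite fpsCM /sc fpsCM mulrCA.
by rewrite series_fpsC expRD; apply: cvgMl_tmp; exact: fps_exp_cvg.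
Qed.

Lemma tame_linear l p : tame_at (linear_form l) p.
Proof.
set c := linear_form l p.
apply: (@tame_comp _ _ (fpsC c + fpsX R) id l p (`|c| + 1) 1 1) => // [n|k _].
  rewrite expr1n mulr1 fpsDE (le_trans (ler_normD _ _)) // lerD //.
    by case: n => [|n] //=; rewrite normr0.
  by rewrite /fpsX; case: eqP; rewrite ?normr1 ?normr0.
rewrite scD scX series_fpsD; apply: cvgD.
  rewrite -(cvg_shiftS (series _)) (_ : (fun n => _) = fun=> c); first exact: (@cvg_cst R).
  apply/funext => n; rewrite /series /= big_nat_recl // big1 ?addr0 /sc /=.
    by rewrite expr0 mul1r.
  by move=> i _; rewrite mulr0.
rewrite -[fpsX R]mulr1 mulrCA -(cvg_shiftS (series _)).
rewrite (_ : (fun n => _) = series (fpsC k * 1)); last by apply/funext => n; exact: series_fpsX.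
rewrite mulr1 -(cvg_shiftS (series _)) (_ : (fun n => _) = fun=> k); first exact: (@cvg_cst R).
by apply/funext => n; rewrite /series /= big_nat_recl // big1 ?addr0.
Qed.

Lemma tame_expm1_div l p : tame_at (fun x => expm1_div (linear_form l x)) p.
Proof.
set c := linear_form l p; have [c0|c0] := eqVneq c 0.
  apply: (@tame_comp _ _ (fps_phi R) _ l p 1 1 1) => // [n|k _].
    rewrite expr1n mulr1 /fps_phi ger0_norm ?invr_ge0 //.
    by rewrite invf_le1 ?ltr0n ?fact_gt0 // ler1n fact_gt0.
  by rewrite -/c c0 add0r; exact: fps_phi_cvg.
have t1 : tame_at (fun x => (expR (linear_form l x) + -1) * (linear_form l x)^-1) p.
  apply: tameM; last by apply: tameV => //; exact: tame_linear.
  by apply: tameD; [exact: tame_expR|exact: tame_cst].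
set La := \sum_i `|l i|; have La0 : 0 <= La by exact: sumr_ge0.
have d0 : 0 < La + 1 by rewrite ltr_wpDl.
(* Within this radius the linear form moves by less than |c|, so it stays nonzero and [expm1_div] is
   the plain quotient. *)
have r0 : 0 < `|c| / (La + 1) by rewrite divr_gt0 // normr_gt0.
apply: (tame_ext r0) t1 => h hr; rewrite /expm1_div ifN //.
have b : `|linear_form l h| < `|c|.
  apply: (le_lt_trans (linear_form_bound l (r := `|c| / (La + 1)) _)) => [i|]; first exact: ltW.
  by rewrite -/La mulrCA gtr_pMr ?normr_gt0 // ltr_pdivrMr // mul1r; lra.
apply: contraTneq b; rewrite linear_formD -/c => /eqP.
by rewrite addrC addr_eq0 => /eqP ->; rewrite normrN ltxx.
Qed.

Lemma tame_bch_sum ls lt lu lv p :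
  tame_at (fun x => bch_sum (linear_form ls x) (linear_form lt x)
    (linear_form lu x) (linear_form lv x)) p.
Proof.
apply: tameM.
  apply: tameD; apply: tameM; [exact: tame_linear|exact: tame_expm1_div|exact: tame_linear|].
  by apply: tameM; [exact: tame_expR|exact: tame_expm1_div].
apply: tameV; first by rewrite gt_eqF // expm1_div_gt0.
have := tame_expm1_div (fun i => ls i + lt i) p; congr tame_at.
apply/funext => x; congr expm1_div; rewrite -big_split.
by apply: eq_bigr => i _; rewrite mulrDl.
Qed.
End AnalyticBch.

(** * Divergence at distance 2 pi *)

Section Divergence.
Variable R : realType.
Implicit Types (f g : fps R) (x y : R).

Notation X := (fpsX R).
Notation E c := (sc c (fps_exp R)).
Notation Phi c := (sc c (fps_phi R)).

(* [(re_i n, im_i n)] are the real and imaginary parts of [i ^ n]. *)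
Fixpoint re_i n : R := if n is n'.+1 then - im_i n' else 1
with im_i n : R := if n is n'.+1 then re_i n' else 0.

Lemma re_im_iD m n : re_i (m + n) = re_i m * re_i n - im_i m * im_i n /\
  im_i (m + n) = re_i m * im_i n + im_i m * re_i n.
Proof.
elim: m => [|m [IHr IHi]] /=; first by rewrite add0n; split; ring.
by rewrite IHr IHi; split; ring.
Qed.

Lemma re_im_iE n : re_i n = (~~ odd n)%:R * (-1) ^+ n./2 /\
  im_i n = (odd n)%:R * (-1) ^+ n.-1./2.
Proof.
elim: n => [|n [IHr IHi]]; first by rewrite /= expr0 mulr1 mul0r.
split; last by rewrite -[im_i n.+1]/(re_i n) IHr.
rewrite -[re_i n.+1]/(- im_i n) IHi; case: n {IHr IHi} => [|n] /=; first by rewrite !mul0r oppr0.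
by rewrite negbK exprS mulN1r mulrN.
Qed.

Lemma re_im_i_le1 n : `|re_i n| <= 1 /\ `|im_i n| <= 1.
Proof.
by elim: n => [|n [IHr IHi]] /=; rewrite ?normr1 ?normr0 ?normrN.
Qed.

Definition re_fps f : fps R := fun n => re_i n * f n.
Definition im_fps f : fps R := fun n => im_i n * f n.

Lemma im_fpsM f g : im_fps (f * g) = re_fps f * im_fps g + im_fps f * re_fps g.
Proof.
apply/funext => n; rewrite fpsDE /im_fps !fpsME mulr_sumr -big_split.
apply: eq_bigr => i _ /=; have lein : (i <= n)%N by rewrite -ltnS.
by rewrite -[in im_i n](subnKC lein) (re_im_iD i (n - i)).2 /re_fps; ring.
Qed.

Lemma re_fps_bounded K q f : geom_bounded K q f -> geom_bounded K q (re_fps f).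
Proof.
move=> fb n; rewrite normrM (le_trans _ (fb n)) // ler_piMl //.
exact: (re_im_i_le1 n).1.
Qed.

Lemma im_fps_bounded K q f : geom_bounded K q f -> geom_bounded K q (im_fps f).
Proof.
move=> fb n; rewrite normrM (le_trans _ (fb n)) // ler_piMl //.
exact: (re_im_i_le1 n).2.
Qed.

Lemma re_exp_cvg y : series (re_fps (E y)) @ \oo --> cos y.
Proof.
have -> : (re_fps (E y) : nat -> R) = cos_coeff y.
  apply/funext => n; rewrite /re_fps (re_im_iE n).1 /cos_coeff /sc /fps_exp /=.
  by rewrite !mulrA.
by rewrite unlock; exact: is_cvg_series_cos_coeff.
Qed.

Lemma im_exp_cvg y : series (im_fps (E y)) @ \oo --> sin y.
Proof.
have -> : (im_fps (E y) : nat -> R) = sin_coeff y.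
  apply/funext => n; rewrite /im_fps (re_im_iE n).2 /sin_coeff /sc /fps_exp /=.
  by rewrite !mulrA.
by rewrite unlock; exact: is_cvg_series_sin_coeff.
Qed.

(** C depends neither on x nor on d: it is the mass of the terms with |c n| > eps, up to a last
    index. The weights d will be [re_i] and [im_i]. *)
Lemma abel_littleo (c : nat -> R) (eps : R) : c @ \oo --> (0 : R) -> 0 < eps ->
  exists2 C : R, 0 <= C & forall x d l, 0 <= x -> x < 1 -> (forall n, `|d n| <= 1) ->
    series (fun n => d n * (x ^+ n * c n)) @ \oo --> l -> `|l| <= C + eps / (1 - x).
Proof.
move=> c0 eps0.
have [N _ cN] : \forall n \near \oo, `|c n| <= eps.
  by move/cvgr0_norm_le : c0; apply.
exists (\sum_(0 <= n < N) `|c n|) => [|x d l x0 x1 d1 dl]; first exact: sumr_ge0.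
have x1' : 0 < 1 - x by rewrite subr_gt0.
have bnd k : `|series (fun n => d n * (x ^+ n * c n)) k| <=
    \sum_(0 <= n < N) `|c n| + eps / (1 - x).
  rewrite /series /= (le_trans (ler_norm_sum _ _ _)) //.
  (* Lengthening the range to N + k allows the cut at N whether or not k exceeds N. *)
  apply: (@le_trans _ _ (\sum_(0 <= n < N + k) x ^+ n * `|c n|)).
    rewrite [leRHS](big_cat_nat (n := k)) ?leq_addl //= ler_wpDr //.
      by rewrite sumr_ge0 // => n _; rewrite mulr_ge0 // exprn_ge0.
    apply: ler_sum => n _; rewrite !normrM normrX (ger0_norm x0).
    by rewrite ler_piMl // mulr_ge0 // exprn_ge0.
  rewrite [leLHS](big_cat_nat (n := N)) ?leq_addr //= lerD //.
    by apply: ler_sum => n _; rewrite ler_piMl // exprn_ile1 // ltW.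
  apply: (@le_trans _ _ (\sum_(N <= n < N + k) x ^+ n * eps)).
    by apply: ler_sum_nat => n /andP[Nn _]; rewrite ler_wpM2l ?exprn_ge0 // cN.
  apply: (@le_trans _ _ (\sum_(0 <= n < N + k) x ^+ n * eps)).
    rewrite [leRHS](big_cat_nat (n := N)) ?leq_addr //= ler_wpDl //.
    by rewrite sumr_ge0 // => n _; rewrite mulr_ge0 ?exprn_ge0 // ltW.
  rewrite -mulr_suml mulrC ler_pM2l // -[leRHS]mul1r ler_pdivlMr // big_mkord.
  rewrite mulrC -opprB mulNr -subrX1 opprB lerBlDr lerDl exprn_ge0 //.
rewrite ler_norml; apply/andP; split.
  apply: (cvgr_to_ge dl); near=> k; have := bnd k; rewrite ler_norml => /andP[]//.
apply: (cvgr_to_le dl); near=> k; have := bnd k; rewrite ler_norml => /andP[]//.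
Unshelve. all: by end_near. Qed.

Lemma norm_sin_le x : 0 <= x -> `|sin x| <= x.
Proof.
move=> x0.
have cs : {within `[0, x]%classic, continuous (@sin R)}.
  by apply: continuous_subspaceT => z; exact: continuous_sin.
have [c _] := MVT_segment x0 (fun z _ => is_derive_sin z) cs.
rewrite sin0 !subr0 => ->; rewrite normrM (ger0_norm x0) ler_piMl //.
exact: cos_max.
Qed.

Lemma bch_fps_2pi_not_cvg0 v : v != 0 -> ~ bch_fps (2 * pi) 0 0 v @ \oo --> (0 : R).
Proof.
move=> v0 W0; set W := bch_fps _ _ _ _ in W0.
pose c := fpsC v^-1 * W.
have c0 : c @ \oo --> (0 : R).
  rewrite (_ : (c : nat -> R) = fun n => v^-1 * W n); last by apply/funext => n; rewrite /c fpsCM.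
  by rewrite -(mulr0 v^-1); apply: cvgMl_tmp.
(* The defining equation of W divided by v and multiplied by e^(2 pi z) - 1 = 2 pi z phi(2 pi z). *)
have cE : c * (E (2 * pi) - 1) = fpsC (2 * pi) * X * E (2 * pi).
  have P0 : Phi 0 = 1.
    apply/funext => -[|n]; rewrite /sc fps1E expr0n /= ?mul0r ?mul1r //.
    by rewrite /fps_phi invr1.
  have := bch_fpsM (2 * pi) 0 0 v.
  rewrite /bch_fps_num P0 addr0 fpsC0 mul0r add0r mulr1 -/W => WE.
  have -> : E (2 * pi) - 1 = fpsC (2 * pi) * X * Phi (2 * pi).
    by rewrite fps_expE scD sc1 scM scX addrC addKr.
  rewrite /c (_ : _ * _ = fpsC v^-1 * fpsC (2 * pi) * X * (W * Phi (2 * pi))); last by ring.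
  rewrite WE (_ : _ * _ = (fpsC v^-1 * fpsC v) * (fpsC (2 * pi) * X * E (2 * pi))); last by ring.
  by rewrite -fpsC_mul mulVf // fpsC1 mul1r.
clearbody c; have e80 : 0 < 8^-1 :> R by lra.
have [C C0 Cb] := abel_littleo c0 e80.
(* The imaginary part of [cE] at i x reads P sin y + Q (cos y - 1) = y cos y, where P and Q are the
   real and imaginary parts of c at i x. *)
have key x : 0 < x -> x < 1 -> `|2 * pi * x * cos (2 * pi * x)| <=
    (C + 8^-1 / (1 - x)) * (`|sin (2 * pi * x)| + `|cos (2 * pi * x) - 1|).
  move=> x0 x1; set y := 2 * pi * x.
  have prod : sc x c * (E y - 1) = fpsC y * X * E y.
    have := congr1 (sc x) cE; rewrite !scM scD scN sc1 scX.
    have -> : sc x (E (2 * pi)) = E y.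
      by apply/funext => n; rewrite /sc mulrA -exprMn [x * _]mulrC.
    have -> : sc x (fpsC (2 * pi)) = fpsC (2 * pi).
      by apply/funext => -[|n]; rewrite /sc /= ?mulr0 // expr0 mul1r.
    by rewrite /y => ->; rewrite !fpsC_mul; ring.
  have [Kc cb] : exists K, forall n, `|c n| <= K.
    have [K [_ Kb]] := cvg_seq_bounded (cvgP _ c0).
    by exists (K + 1) => n; apply: (Kb (K + 1)); rewrite ?ltrDl.
  have scb : geom_bounded Kc x (sc x c).
    move=> n; rewrite /sc normrM normrX (ger0_norm (ltW x0)) mulrC.
    by rewrite ler_wpM2r // exprn_ge0 // ltW.
  have [K Eb] := fps_exp_bounded y x0.
  have b1 : geom_bounded (K + 1) x (E y - 1).
    move=> n; case: n => [|n].
      rewrite fpsDE fpsNE fps1E /sc /fps_exp invr1 mulr1 expr0 subrr normr0.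
      by rewrite mulr1 addr_ge0 // (geom_bounded_ge0 Eb).
    apply: le_trans (_ : K * x ^+ n.+1 <= _).
      by rewrite fpsDE fpsNE fps1E subr0.
    by rewrite ler_wpM2r ?lerDl // exprn_ge0 // ltW.
  have c1 := geom_bounded_is_cvg (ltW x0) x1 (re_fps_bounded scb).
  have c2 := geom_bounded_is_cvg (ltW x0) x1 (im_fps_bounded scb).
  have s2 : series (im_fps (E y - 1)) @ \oo --> sin y.
    rewrite (_ : im_fps (E y - 1) = im_fps (E y)); first exact: im_exp_cvg.
    apply/funext => -[|n]; rewrite /im_fps fpsDE fpsNE fps1E ?mul0r //.
    by rewrite subr0.
  have one_cvg : series (1 : fps R) @ \oo --> (1 : R) by exact: fps1_cvg.
  have s1 : series (re_fps (E y - 1)) @ \oo --> cos y - 1.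
    rewrite (_ : re_fps (E y - 1) = re_fps (E y) + fpsC (-1)).
      rewrite series_fpsD; apply: cvgD; first exact: re_exp_cvg.
      rewrite -[fpsC _]mulr1 series_fpsC -[X in _ --> X]mulr1.
      by apply: cvgMl_tmp.
    apply/funext => n; rewrite /re_fps !fpsDE fpsNE fps1E.
    by case: n => [|n] /=; rewrite ?mul1r // subr0 addr0.
  have p1 := cauchy_product (ltW x0) x1 (re_fps_bounded scb) (im_fps_bounded b1) c1 s2.
  have p2 := cauchy_product (ltW x0) x1 (im_fps_bounded scb) (re_fps_bounded b1) c2 s1.
  set P := limn _ in p1; set Q := limn _ in p2.
  have lim1 : series (im_fps (sc x c * (E y - 1))) @ \oo -->
      P * sin y + Q * (cos y - 1).
    by rewrite im_fpsM series_fpsD; exact: cvgD p1 p2.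
  have lim2 : series (im_fps (sc x c * (E y - 1))) @ \oo --> y * cos y.
    rewrite prod (_ : im_fps _ = X * (fpsC y * re_fps (E y))); last first.
      apply/funext => -[|n]; first by rewrite /im_fps mul0r fpsXM0.
      rewrite /im_fps /= fpsXM fpsCM [fpsC y * X]mulrC -mulrA fpsXM fpsCM.
      by rewrite /re_fps mulrCA.
    rewrite -(cvg_shiftS (series _)).
    rewrite (_ : (fun n => _) = series (fpsC y * re_fps (E y))); last first.
      by apply/funext => n; exact: series_fpsX.
    by rewrite series_fpsC; apply: cvgMl_tmp; exact: re_exp_cvg.
  have <- : P * sin y + Q * (cos y - 1) = y * cos y.
    exact: (cvg_unique (@norm_hausdorff _ _) lim1 lim2).
  have PB := Cb x re_i P (ltW x0) x1 (fun n => (re_im_i_le1 n).1) c1.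
  have QB := Cb x im_i Q (ltW x0) x1 (fun n => (re_im_i_le1 n).2) c2.
  rewrite (le_trans (ler_normD _ _)) // !normrM mulrDr.
  by rewrite lerD // ler_wpM2r.
(* With x = 1 - d and z = 2 pi d <= 8 d, the choice of d gives z <= 1/4 and C z <= 1/4. Then cos z
   >= 31/32 and |sin z| + |cos z - 1| <= 9 z / 8. *)
have C1 : 0 < 32 * (C + 1) by lra.
pose d : R := Num.min (1 / 32) (1 / (32 * (C + 1))).
have d0 : 0 < d.
  rewrite lt_min; apply/andP; split; first by lra.
  by rewrite div1r invr_gt0.
have d1 : d <= 1 / 32 by rewrite ge_min lexx.
have Cd : C * d <= 1 / 32.
  apply: (@le_trans _ _ (C * (1 / (32 * (C + 1))))).
    by apply: ler_wpM2l => //; rewrite ge_min lexx orbT.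
  by rewrite mulrA mulr1 ler_pdivrMr //; lra.
have [pi2 pi4] : 2 <= pi :> R /\ pi < 4 :> R.
  split; first exact: pi_ge2.
  by have /andP[_] := pihalf_02 R; rewrite ltr_pdivrMr //; lra.
have {key} := key (1 - d); have -> : 1 - (1 - d) = d by ring.
set z := 2 * pi * d.
have xz : 2 * pi * (1 - d) = pi *+ 2 - z by rewrite /z -mulr_natl; ring.
have -> : sin (2 * pi * (1 - d)) = - sin z.
  by rewrite xz sinB sin2pi cos2pi mul0r mul1r sub0r.
have -> : cos (2 * pi * (1 - d)) = cos z.
  by rewrite xz cosB sin2pi cos2pi mul0r mul1r addr0.
rewrite normrN => key.
have z0 : 0 <= z by rewrite !mulr_ge0 // ?pi_ge0 // ltW.
have zle : z <= 8 * d by rewrite ler_wpM2r ?(ltW d0) //; lra.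
have sz := norm_sin_le z0.
have hz := @norm_sin_le (z / 2) (divr_ge0 z0 (ler0n _ _)).
have cz : 1 - cos z = 2 * sin (z / 2) ^+ 2.
  rewrite {1}(_ : z = (z / 2) *+ 2); last by rewrite -mulr_natl mulrCA divff ?mulr1.
  by rewrite cos_mulr2n cos2sin2; ring.
have s2 : sin (z / 2) ^+ 2 <= (z / 2) ^+ 2.
  by rewrite -[leLHS]real_normK ?num_real // lerXn2r ?nnegrE // divr_ge0.
have s20 : 0 <= sin (z / 2) ^+ 2 by exact: sqr_ge0.
have cz1 : `|cos z - 1| <= z ^+ 2 / 2.
  rewrite distrC cz ger0_norm; last exact: mulr_ge0.
  have e : z ^+ 2 / 2 = 2 * (z / 2) ^+ 2 by field.
  by rewrite e ler_wpM2l.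
have cz2 : 1 - z ^+ 2 / 2 <= cos z.
  by rewrite lerBlDl -lerBlDr (le_trans _ cz1) // distrC ler_norm.
have d1' : 1 - d < 1 by lra.
have d0' : 0 < 1 - d by lra.
have {key} := key d0' d1'.
have z2 : z ^+ 2 / 2 <= z / 8.
  have : z * z <= 1 / 4 * z by apply: ler_wpM2r => //; lra.
  by rewrite expr2; lra.
have lhs : 2 * pi * (31 / 32 * (31 / 32)) <= 2 * pi * (1 - d) * cos z.
  rewrite -[leRHS]mulrA; apply: ler_wpM2l; first by rewrite mulr_ge0 ?pi_ge0.
  by apply: ler_pM; lra.
(* The part of the bound growing like 1/d meets z = 2 pi d and leaves 2 pi times 9/64, too small
   against the lower bound 2 pi (31/32)^2. *)
have rhs : (C + 8^-1 / d) * (`|sin z| + `|cos z - 1|) <= 9 / 32 + 2 * pi * (9 / 64).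
  apply: (@le_trans _ _ ((C + 8^-1 / d) * (9 / 8 * z))).
    apply: ler_wpM2l; first by rewrite addr_ge0 // divr_ge0 // ltW.
    by lra.
  have -> : (C + 8^-1 / d) * (9 / 8 * z) = 9 / 8 * (C * z) + 2 * pi * (9 / 64).
    by rewrite /z; field; rewrite gt_eqF.
  have : C * z <= C * (8 * d) by apply: ler_wpM2l.
  by lra.
have := ler_norm (2 * pi * (1 - d) * cos z).
have : 2 * pi * (31 / 32 * (31 / 32) - 9 / 64) >= 4 * (31 / 32 * (31 / 32) - 9 / 64) :> R.
  by apply: ler_wpM2r; lra.
by lra.
Qed.
End Divergence.

(** * The algebra spanned by A, B and C *)

Section Example.
Variable R : realType.
Implicit Types (a b c : R) (M X Y : 'M[R]_3).

Notation o0 := (@Ordinal 3 0 isT).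
Notation o1 := (@Ordinal 3 1 isT).
Notation o2 := (@Ordinal 3 2 isT).
Notation g := (gABC R).

Let piN0 : 2 * pi != 0 :> R.
Proof. by rewrite mulf_neq0 ?pnatr_eq0 // gt_eqF // pi_gt0. Qed.

Definition abc a b c : 'M[R]_3 := a *: mxA + b *: mxB + c *: mxC.

Lemma abcE a b c : abc a b c = mx3
  [:: [:: 0; 0; 0]; [:: - (2 * pi * b); 2 * pi * a; 0]; [:: - c; 0; a]].
Proof.
apply/matrixP => -[[|[|[|i]]] hi] [[|[|[|j]]] hj] //;
  by rewrite !mxE /=; ring.
Qed.

Lemma abc_mem a b c : abc a b c \in g.
Proof.
rewrite /gABC !span_cons span_nil addv0 /abc -addrA.
by rewrite !memv_add // memvZ // memv_line.
Qed.

Lemma memg_abc M : M \in g -> exists a b c, M = abc a b c.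
Proof.
rewrite /gABC !span_cons span_nil addv0.
move=> /memv_addP[_ /vlineP[a ->] [_ /memv_addP[_ /vlineP[b ->] [_ /vlineP[c ->] ->]] ->]].
by exists a, b, c; rewrite /abc addrA.
Qed.

Lemma lie_abc a b c a' b' c' : lie (abc a b c) (abc a' b' c') =
  abc 0 (2 * pi * (a * b' - a' * b)) (a * c' - a' * c).
Proof.
rewrite /lie !abcE; apply/matrixP => -[[|[|[|i]]] hi] [[|[|[|j]]] hj] //;
  by rewrite !mxE !big_ord_recr !big_ord0 /= !mxE /=; ring.
Qed.

Lemma lie_closed X Y : X \in g -> Y \in g -> lie X Y \in g.
Proof.
move=> /memg_abc[a [b [c ->]]] /memg_abc[a' [b' [c' ->]]].
by rewrite lie_abc abc_mem.
Qed.

Lemma memg_coords M : M \in g -> M = abc (M o2 o2) (- M o1 o0 / (2 * pi)) (- M o2 o0).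
Proof.
move=> /memg_abc[a [b [c ->]]]; congr abc; rewrite abcE !mxE //= ?opprK //.
by rewrite mulrAC divff // mul1r.
Qed.

Lemma bch_mem n X Y : X \in g -> Y \in g -> bch n X Y \in g.
Proof.
move=> Xg Yg; apply: memvZ; apply: memv_suml => k _; apply: memvZ.
apply: memv_suml => t _; apply: memvZ.
by apply: (nested_bracket_closed (G := fun M => M \in g)) => //; [exact: mem0v|exact: lie_closed].
Qed.

(** For i = 1, 2 the map sending X to (X i i, X i 0) is a Lie homomorphism from g to the affine
    algebra: these are the two weight spaces. *)
Let offdiag (i : 'I_3) n X Y : i != o0 -> X \in g -> Y \in g ->
  (bch n.+1 X Y) i o0 = bch_fps (X i i) (Y i i) (X i o0) (Y i o0) n.
Proof.
move=> i0 Xg Yg.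
apply: (@affine_bch R 'M[R]_3 (fun M => M \in g) (fun M => M i i) (fun M => M i o0)) => //.
- exact: mem0v.
- exact: lie_closed.
- move=> x y /memg_abc[a [b [c ->]]] /memg_abc[a' [b' [c' ->]]].
  rewrite lie_abc !abcE; case: i i0 => [[|[|[|i]]] hi] // _; rewrite !mxE /=; ring.
- by move=> x y; rewrite mxE.
- by move=> k x; rewrite mxE.
- move=> x y /memg_abc[a [b [c ->]]] /memg_abc[a' [b' [c' ->]]].
  rewrite lie_abc !abcE; case: i i0 => [[|[|[|i]]] hi] // _; rewrite !mxE /=; ring.
Qed.

(** Diagonal entries of commutators vanish, so the affine computation applies with [dg] = 0, where
    the group law is addition. *)
Let diag n X Y : X \in g -> Y \in g ->
  (bch n.+1 X Y) o2 o2 = fpsC (X o2 o2 + Y o2 o2) n.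
Proof.
move=> Xg Yg.
have := @affine_bch R 'M[R]_3 (fun M => M \in g) (fun=> 0) (fun M => M o2 o2).
move=> /(_ (mem0v _) lie_closed) -> //.
- rewrite /bch_fps /bch_fps_num addr0.
  have -> : sc 0 (fps_phi R) = 1.
    apply/funext => -[|k]; rewrite /sc fps1E expr0n /= ?mul0r ?mul1r //.
    by rewrite /fps_phi invr1.
  have -> : sc 0 (fps_exp R) = 1.
    apply/funext => -[|k]; rewrite /sc fps1E expr0n /= ?mul0r ?mul1r //.
    by rewrite /fps_exp invr1.
  rewrite !mulr1 (_ : fpsinv 1 = 1) ?mulr1 -?fpsCD //.
  by rewrite -[LHS]mul1r fpsMV.
- by move=> x y; rewrite mxE.
- by move=> k x; rewrite mxE.
- move=> x y /memg_abc[a [b [c ->]]] /memg_abc[a' [b' [c' ->]]].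
  by rewrite lie_abc !abcE !mxE /=; ring.
Qed.

(** The signs and the division by 2 pi convert matrix entries to coordinates in A, B, C, as in
    [memg_coords]. *)
Definition bch_prolongation X Y : 'M[R]_3 :=
  abc (X o2 o2 + Y o2 o2)
    (- bch_sum (X o1 o1) (Y o1 o1) (X o1 o0) (Y o1 o0) / (2 * pi))
    (- bch_sum (X o2 o2) (Y o2 o2) (X o2 o0) (Y o2 o0)).

Lemma norm_entry_le M i j : `|M i j| <= `|M|.
Proof.
rewrite [leRHS]/Num.norm /= mx_normrE.
exact: (le_bigmax _ (fun ij : 'I_3 * 'I_3 => `|M ij.1 ij.2|) (i, j)).
Qed.

Lemma bch_cvg X Y : X \in g -> Y \in g -> `|X| < 16^-1 -> `|Y| < 16^-1 ->
  series (bch_seq X Y) @ \oo --> bch_prolongation X Y.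
Proof.
move=> Xg Yg Xs Ys.
have sm M i j : `|M| < 16^-1 -> `|M i j| <= 1 / 16.
  by move=> Ms; rewrite div1r ltW // (le_lt_trans (norm_entry_le M i j)).
set W1 := bch_fps (X o1 o1) (Y o1 o1) (X o1 o0) (Y o1 o0).
set W2 := bch_fps (X o2 o2) (Y o2 o2) (X o2 o0) (Y o2 o0).
set d := fpsC (X o2 o2 + Y o2 o2).
(* The partial sums are rebuilt from three scalar series, so that the matrix limit follows
   coordinatewise. *)
have -> : series (bch_seq X Y) = fun N => series d N *: mxA +
    (- series W1 N / (2 * pi)) *: mxB + (- series W2 N) *: mxC.
  apply/funext => N; elim: N => [|N IH].
    by rewrite /series /= !big_geq // oppr0 mul0r !scale0r !addr0.
  rewrite [LHS]/series /= big_nat_recr //= -[\sum_(0 <= k < N) _]/(series (bch_seq X Y) N) IH.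
  rewrite !seriesS /bch_seq [bch _ _ _]memg_coords ?bch_mem // diag // !offdiag //.
  rewrite /abc -/W1 -/W2 -/d !opprD !mulrDl !scalerDl.
  rewrite addrACA [X in X + _ = _]addrACA.
  by congr (_ + _ + _); exact: addrC.
have cd : series d @ \oo --> X o2 o2 + Y o2 o2.
  rewrite -(cvg_shiftS (series d)) (_ : (fun n => _) = fun=> X o2 o2 + Y o2 o2).
    exact: (@cvg_cst R).
  by apply/funext => n; rewrite /series /= big_nat_recl // big1 ?addr0.
have c1 := @bch_fps_cvg R _ _ (X o1 o0) (Y o1 o0) (sm X o1 o1 Xs) (sm Y o1 o1 Ys).
have c2 := @bch_fps_cvg R _ _ (X o2 o0) (Y o2 o0) (sm X o2 o2 Xs) (sm Y o2 o2 Ys).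
apply: cvgD; first apply: cvgD.
- exact: cvgZr_tmp.
- by apply: cvgZr_tmp; apply: cvgMr_tmp; apply: cvgN.
- by apply: cvgZr_tmp; apply: cvgN.
Qed.

(** Convergence would force the terms to 0, hence also their entries (1, 0), which are the
    coefficients of [bch_fps (2 * pi) 0 0 (- (2 * pi))]. *)
Lemma bch_not_cvg : ~ cvgn (series (bch_seq (mxA : 'M[R]_3) mxB)).
Proof.
move=> /cvg_series_cvg_0 c0.
have Ag : (mxA : 'M[R]_3) \in g by rewrite -[mxA](_ : abc 1 0 0 = _) ?abc_mem // /abc scale1r !scale0r !addr0.
have Bg : (mxB : 'M[R]_3) \in g by rewrite -[mxB](_ : abc 0 1 0 = _) ?abc_mem // /abc scale1r !scale0r add0r addr0.
have v0 : - (2 * pi) != 0 :> R by rewrite oppr_eq0.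
apply: (bch_fps_2pi_not_cvg0 v0).
have := cvg_comp _ _ c0 (@coord_continuous R 3 3 o1 o0 0).
rewrite mxE; apply: cvg_trans; apply: near_eq_cvg; apply: nearW => n /=.
rewrite /bch_seq offdiag //.
by rewrite !mxE /=.
Qed.

Definition prolongation (z : subvs_of g * subvs_of g) : subvs_of g :=
  vsproj g (bch_prolongation (vsval z.1) (vsval z.2)).

Lemma prolongation_analytic : real_analytic prolongation.
Proof.
move=> p j; apply: tame_analytic.
set eV := vbasis _; set eU := vbasis _.
set n := \dim _ in p eU *.
pose lX (i k : 'I_3) : 'I_n -> R := fun l => vsval (eU`_l).1 i k.
pose lY (i k : 'I_3) : 'I_n -> R := fun l => vsval (eU`_l).2 i k.
have XE i k (u : 'I_n -> R) : vsval (\sum_(i0 < n) u i0 *: eU`_i0).1 i k = linear_form (lX i k) u.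
  rewrite (big_morph (fun z : subvs_of g * subvs_of g => z.1) (id1 := 0) (op1 := +%R)) //.
  rewrite linear_sum summxE; apply: eq_bigr => l _.
  by rewrite linearZ mxE mulrC.
have YE i k (u : 'I_n -> R) : vsval (\sum_(i0 < n) u i0 *: eU`_i0).2 i k = linear_form (lY i k) u.
  rewrite (big_morph (fun z : subvs_of g * subvs_of g => z.2) (id1 := 0) (op1 := +%R)) //.
  rewrite linear_sum summxE; apply: eq_bigr => l _.
  by rewrite linearZ mxE mulrC.
(* The j-th coordinate on g becomes a linear functional on all matrices through [vsproj], so it is
   determined on g by its values at A, B, C. *)
pose k M : R := coord eV j (vsproj g M).
have kE a b c : k (abc a b c) = a * k mxA + b * k mxB + c * k mxC.
  by rewrite /k /abc !linearD !linearZ.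
have -> : (fun u : 'I_n -> R => coord eV j (prolongation (\sum_(i < n) u i *: eU`_i))) =
  fun u : 'I_n -> R => ((linear_form (lX o2 o2) u + linear_form (lY o2 o2) u) * k mxA +
   (-1 * bch_sum (linear_form (lX o1 o1) u) (linear_form (lY o1 o1) u)
     (linear_form (lX o1 o0) u) (linear_form (lY o1 o0) u) * (2 * pi)^-1) * k mxB) +
   (-1 * bch_sum (linear_form (lX o2 o2) u) (linear_form (lY o2 o2) u)
     (linear_form (lX o2 o0) u) (linear_form (lY o2 o0) u)) * k mxC.
  apply/funext => u; rewrite /prolongation -/(k _) kE !XE !YE.
  by rewrite !mulN1r.
apply: tameD; first apply: tameD.
- apply: tameM; last exact: tame_cst.
  by apply: tameD; exact: tame_linear.
- apply: tameM; last exact: tame_cst.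
  apply: tameM; last exact: tame_cst.
  by apply: tameM; [exact: tame_cst|exact: tame_bch_sum].
- apply: tameM; last exact: tame_cst.
  by apply: tameM; [exact: tame_cst|exact: tame_bch_sum].
Qed.
End Example.

Theorem mainTheorem4 (R : realType) :
  (lie mxA mxB = (2 * pi) *: (mxB : 'M[R]_3) /\
   lie mxA mxC = (mxC : 'M[R]_3) /\
   lie mxB mxC = (0 : 'M[R]_3)) /\
  (forall X Y : 'M[R]_3, X \in gABC R -> Y \in gABC R -> lie X Y \in gABC R) /\
  (exists e : R, 0 < e /\
    forall X Y : 'M[R]_3, X \in gABC R -> Y \in gABC R ->
      `|X| < e -> `|Y| < e ->
      exists Z : 'M[R]_3, Z \in gABC R /\ series (bch_seq X Y) @ \oo --> Z) /\
  (exists P : subvs_of (gABC R) * subvs_of (gABC R) -> subvs_of (gABC R),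
    real_analytic P /\
    exists e : R, 0 < e /\
      forall X Y : subvs_of (gABC R), `|vsval X| < e -> `|vsval Y| < e ->
        series (bch_seq (vsval X) (vsval Y)) @ \oo --> vsval (P (X, Y))) /\
  ~ cvgn (series (bch_seq (mxA : 'M[R]_3) mxB)).
Proof.
have AE : abc 1 0 0 = mxA :> 'M[R]_3 by rewrite /abc scale1r !scale0r !addr0.
have BE : abc 0 1 0 = mxB :> 'M[R]_3 by rewrite /abc scale1r !scale0r add0r addr0.
have CE : abc 0 0 1 = mxC :> 'M[R]_3 by rewrite /abc scale1r !scale0r !add0r.
have e0 : 0 < 16^-1 :> R by rewrite invr_gt0.
split; first split; [|split|].
- rewrite -{1}AE -{1}BE lie_abc /abc !(mul0r, mulr0, mul1r, mulr1, subr0).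
  by rewrite !scale0r add0r addr0.
- by rewrite -{1}AE -{1}CE lie_abc !(mul0r, mulr0, mul1r, mulr1, subr0) CE.
- by rewrite -{1}BE -{1}CE lie_abc !(mul0r, mulr0, mul1r, mulr1, subr0) /abc !scale0r !addr0.
split; first exact: lie_closed.
split.
  exists 16^-1; split=> // X Y Xg Yg Xs Ys; exists (bch_prolongation X Y).
  by split; [exact: abc_mem|exact: bch_cvg].
split; last exact: bch_not_cvg.
exists (@prolongation R); split; first exact: prolongation_analytic.
exists 16^-1; split=> // X Y Xs Ys.
by rewrite vsprojK ?abc_mem //; apply: bch_cvg => //; exact: subvsP.
Qed.
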